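(* Let $n\ge 1$ and let $X\sim\mathcal N(0,I_{n\times n})$ be the standard Gaussian vector in $\mathbb R^n$. Then for every $f\in C_0^\infty(\mathbb R^n)$, $$\log \mathbb E\, e^{f(X)-\mathbb E f(X)}\le 10\,\mathbb E\left[e^{\frac12|\nabla f(X)|^2}\,(1+|\nabla f(X)|)^{-1}\right].$$
   Context: $C_0^\infty(\mathbb R^n)$ denotes the real-valued infinitely differentiable compactly supported functions on $\mathbb R^n$; $|\cdot|$ is the Euclidean norm. *)

(* Defs.v *)
From HB Require Import structures.
From mathcomp Require Import all_boot all_order all_algebra.
From mathcomp Require Import all_classical all_reals all_analysis.
Set Implicit Arguments.
Unset Strict Implicit.
Unset Printing Implicit Defensive.
Import Order.TTheory GRing.Theory Num.Theory.
Import numFieldNormedType.Exports.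
Local Open Scope classical_set_scope.
Local Open Scope ring_scope.

Definition partial (R : realType) (n : nat) (i : 'I_n) (f : 'rV[R]_n -> R) :
    'rV[R]_n -> R :=
  fun x => 'D_(delta_mx ord0 i) f x.

Definition grad (R : realType) (n : nat) (f : 'rV[R]_n -> R) (x : 'rV[R]_n) :
    'rV[R]_n :=
  \row_i partial i f x.

(* The library norm [`|x|] on ['rV[R]_n] is the sup norm. *)
Definition enorm (R : realType) (n : nat) (x : 'rV[R]_n) : R :=
  Num.sqrt (\sum_(i < n) x ord0 i ^+ 2).

(* [foldr (@partial R n) f [:: i1; ...; ik]] is d_i1 ... d_ik f; for the empty
   sequence it is [f] itself. ['D_v] takes a junk value where the directional
   derivative does not exist, hence the explicit [derivable]. *)
Definition smooth (R : realType) (n : nat) (f : 'rV[R]_n -> R) : Prop :=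
  forall s : seq 'I_n,
    continuous (foldr (@partial R n) f s) /\
    (forall (i : 'I_n) (x : 'rV[R]_n),
       derivable (foldr (@partial R n) f s) x (delta_mx ord0 i)).

Definition compactly_supported (R : realType) (n : nat) (f : 'rV[R]_n -> R) :
    Prop :=
  compact (closure [set x | f x != 0]).

(* X ~ N(0, I_n): the coordinates of X are mutually independent standard normal
   random variables. Taking some [A i := setT] in the product rule gives it for
   every subfamily. [normal_prob m s] has mean [m] and standard deviation [s],
   and is only meaningful as a measure on measurable sets. *)
Definition std_gaussian_vector (R : realType) (n : nat) (d : measure_display)
    (T : measurableType d) (P : probability T R) (X : T -> 'rV[R]_n) : Prop :=
  [/\ forall i : 'I_n, measurable_fun [set: T] (fun w => X w ord0 i),
      forall A : 'I_n -> set R, (forall i, measurable (A i)) ->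
        P [set w | forall i, A i (X w ord0 i)] =
        (\prod_(i < n) P [set w | A i (X w ord0 i)])%E
    & forall (i : 'I_n) (B : set R), measurable B ->
        P [set w | B (X w ord0 i)] = normal_prob 0 1 B].

(* Main.v *)
Require Import Defs.
From HB Require Import structures.
From mathcomp Require Import all_boot all_order all_algebra.
From mathcomp Require Import all_classical all_reals all_analysis.
From mathcomp Require Import measurable_realfun.
From mathcomp Require Import ring lra.
Set Implicit Arguments.
Unset Strict Implicit.
Unset Printing Implicit Defensive.
Import Order.TTheory GRing.Theory Num.Theory.
Import numFieldNormedType.Exports.
Local Open Scope classical_set_scope.
Local Open Scope ring_scope.

(** Put [N x r = ln x + psi (r / x^2)] with [psi r = 8 e^(r/2) / sqrt (2 + r)].
    Along a random walk with steps [+-eps e_i], write [u] for the conditional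
    expectation of [e^f] and [t_i] for the time elapsed in direction [i]. The
    function [psi] satisfies a differential inequality that makes
    [N (u, sum_i t_i (d_i u)^2)] a submartingale up to an error [O(eps^3)] per
    step. Starting from [u = E e^f], [t = 0] and ending at [u = e^f], [t = 1]
    after [O(eps^-2)] steps, one gets
    [ln (E e^f) + psi 0 <= E f + E (psi |grad f|^2) + O(eps)] for the walk.
    The central limit theorem (here by comparison with the Gaussian semigroup
    in one coordinate at a time, through Gaussian integration by parts) turns
    the walk into [X], and [psi (s^2) <= 10 e^(s^2/2) / (1 + s)]. *)

(** * The Bellman function *)

Section calculus.
Context {R : realType}.

(** A step in direction [i] moves [u] by [h]. With frozen clocks it would move the weighted square
    of the gradient along a parabola [A0 + 2 t B0 + t^2 C0]; the advance of the clock [t_i] alone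
    adds about [h^2]. A clock common to all directions would add [eps^2 |grad u|^2], which the
    displacement of [u] in a single direction does not control. Convexity of [N] along this path, in
    the worst case of Cauchy-Schwarz [B0^2 <= A0 C0], is positivity of a binary quadratic form; its
    discriminant is the differential inequality for [psi]. There only [ln] breaks homogeneity in
    [psi], so a large enough multiple of a suitable profile works. The profile
    [e^(r/2) / sqrt (2 + r)] is a smooth stand-in for [e^(r/2) / (1 + sqrt r)], and the factor 8 is
    large enough for the inequality while [8 / sqrt (2 + s^2) <= 10 / (1 + s)]. A walk in place of
    the heat flow keeps every intermediate function a finite average of translates, so nothing is
    differentiated under an integral in [n] variables. The law of [X] is given on product sets only,
    hence expectations are reached through finite grids. *)

Lemma mean_value {f df : R -> R} {a b : R} : a <= b ->
  (forall x, a <= x <= b -> is_derive x 1 f (df x)) ->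
  exists2 c, a <= c <= b & f b - f a = df c * (b - a).
Proof.
move=> ab fdf.
have [x xab||c cab ->] := @MVT_segment R f df a b ab.
- by apply: fdf; move: xab; rewrite in_itv/= => /andP[/ltW-> /ltW->].
- apply: derivable_within_continuous => x xab.
  by have [] := fdf x _ => //; move: xab; rewrite in_itv.
- by exists c.
Qed.

Lemma lipschitz_of_derive_bound {f df : R -> R} {a b : R} (M : R) : a <= b ->
  (forall x, a <= x <= b -> is_derive x 1 f (df x)) ->
  (forall x, a <= x <= b -> `|df x| <= M) -> `|f b - f a| <= M * (b - a).
Proof.
move=> ab fdf dfM; have [c cab ->] := mean_value ab fdf.
by rewrite normrM (ger0_norm (_ : 0 <= b - a)) ?subr_ge0// ler_wpM2r ?subr_ge0 ?dfM.
Qed.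

(** The mean value theorem is used twice: for the symmetrisation [t |-> f t + f (- t)] on [[0, 1]],
    then for [df] between [- c] and [c]. The result is [2 * c * ddf d] with [0 <= c <= 1]. *)
Lemma midpoint_convex_defect {f df ddf : R -> R} (kappa : R) :
  (forall t : R, -1 <= t <= 1 -> is_derive t 1 f (df t)) ->
  (forall t : R, -1 <= t <= 1 -> is_derive t 1 df (ddf t)) ->
  (forall t : R, -1 <= t <= 1 -> - kappa <= ddf t) -> 0 <= kappa ->
  2 * f 0 - 2 * kappa <= f 1 + f (-1).
Proof.
move=> fdf dfddf ddfk k0.
have t01 (t : R) : 0 <= t <= 1 -> -1 <= - t <= 1 by lra.
have [||c c01 E] := @mean_value (fun t => f t + f (- t)) (fun t => df t - df (- t)) 0 1.
- by [].
- move=> t ht; have h1 : is_derive t 1 f (df t) by apply: fdf; lra.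
  have h2 : is_derive (- t) 1 f (df (- t)) by apply: fdf; exact: t01.
  have h3 : is_derive t 1 (f \o -%R) (df (- t) * -1) by apply: is_derive1_comp.
  by rewrite -[X in _ - X]mulr1 -mulrN; apply: is_deriveD.
have [||d dc D] := @mean_value df ddf (- c) c.
- by lra.
- by move=> t ht; apply: dfddf; lra.
have : - kappa <= ddf d by apply: ddfk; lra.
move: E D; rewrite oppr0 opprK addr0 mulr1 => E D H; nra.
Qed.

End calculus.

Section bellman.
Context {R : realType}.
Implicit Types r x a b : R.

(** The square root sits in the exponent, so that positivity is immediate and each derivative is
    [psi] times a rational function. *)
Definition psi r : R := 8 * expR (r / 2 - ln (2 + r) / 2).
Definition dpsi r : R := psi r * ((1 + r) / (2 * (2 + r))).
Definition ddpsi r : R := psi r * ((r ^+ 2 + 2 * r + 3) / (4 * (2 + r) ^+ 2)).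

Lemma is_derive_psi r : 0 <= r -> is_derive r 1 psi (dpsi r).
Proof.
move=> r0; have B0 : 0 < 2 + r by lra.
have := is_derive1_ln B0 => H; rewrite /psi; apply: is_derive_eq.
rewrite /GRing.scale /= /dpsi /psi; field.
by rewrite gt_eqF.
Qed.

Lemma is_derive_dpsi r : 0 <= r -> is_derive r 1 dpsi (ddpsi r).
Proof.
move=> r0; have B0 : 2 * (2 + r) != 0 by rewrite gt_eqF//; lra.
have B1 : 2 + r != 0 by rewrite gt_eqF//; lra.
have H := is_derive_psi r0.
have H2 : is_derive r 1 (fun r : R => (2 * (2 + r))^-1) (- (2 * (2 + r)) ^- 2 * 2).
  have H3 : is_derive r 1 (fun r : R => 2 * (2 + r)) 2.
    by apply: is_derive_eq; rewrite /GRing.scale /=; lra.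
  exact: (@is_deriveV _ (fun r : R => 2 * (2 + r))).
rewrite /dpsi; apply: is_derive_eq.
rewrite /GRing.scale /= /ddpsi /dpsi; field.
by [].
Qed.

Lemma psi_gt0 r : 0 < psi r.
Proof. by rewrite mulr_gt0// expR_gt0. Qed.

(* Equivalent, up to positive factors, to the differential inequality [bellman_discr]. *)
Lemma psi_lb r : 0 <= r ->
  (2 + r) * (r ^+ 3 + 3 * r ^+ 2 + 6 * r + 2) < psi r * ((1 + r) * (4 * r + 2)).
Proof.
move=> r0; have B0 : 0 < 2 + r by lra.
pose q := expR (ln (2 + r) / 2); pose e := expR (r / 8).
have q0 : 0 < q by exact: expR_gt0.
have e1 : 1 + r / 8 <= e by exact: expR_ge1Dx.
have qB : q ^+ 2 = 2 + r.
  by rewrite /q -expRM_natl mulrC divfK// lnK// posrE.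
have psiq : psi r * q = 8 * e ^+ 4.
  rewrite /psi /e -expRM_natl -mulrA -expRD; by congr (_ * expR _); field.
(* Tangent line of the square root at [2 + r = 4], in the form [(q - 2)^2 >= 0]. *)
have q4 : q <= (6 + r) / 4 by have := sqr_ge0 (q - 2); lra.
have e4 : 1 + r / 2 + 3 * r ^+ 2 / 32 + r ^+ 3 / 128 <= e ^+ 4.
  apply: (@le_trans _ _ ((1 + r / 8) ^+ 4)); last first.
    by rewrite lerXn2r// nnegrE; lra.
  have : 0 <= r ^+ 4 by rewrite exprn_ge0.
  lra.
have K : 8 * e ^+ 4 <= psi r * ((6 + r) / 4).
  by rewrite -psiq ler_wpM2l// ltW// psi_gt0.
have C0 : 0 <= (1 + r) * (4 * r + 2) by nra.
suff : (6 + r) / 4 * ((2 + r) * (r ^+ 3 + 3 * r ^+ 2 + 6 * r + 2)) <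
       (6 + r) / 4 * (psi r * ((1 + r) * (4 * r + 2))).
  by rewrite ltr_pM2l//; lra.
rewrite [ltRHS]mulrA [(6 + r) / 4 * psi r]mulrC.
apply: (@lt_le_trans _ _ (8 * e ^+ 4 * ((1 + r) * (4 * r + 2)))); last first.
  by rewrite ler_wpM2r.
apply: (@lt_le_trans _ _ (8 * (1 + r / 2 + 3 * r ^+ 2 / 32 + r ^+ 3 / 128) *
  ((1 + r) * (4 * r + 2)))); last first.
  by rewrite ler_wpM2r// ler_wpM2l.
rewrite -subr_gt0.
(* The terms in [r^5] cancel exactly for the factor 8 of [psi], and all the remaining coefficients
   are positive. *)
rewrite [ltRHS](_ : _ = 10 + 34 * r + 36 * r ^+ 2 + (81 / 8) * r ^+ 3
  + (5 / 8) * r ^+ 4); last by field.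
have := exprn_ge0 2 r0; have := exprn_ge0 3 r0; have := exprn_ge0 4 r0; lra.
Qed.

(** Positivity of the leading coefficient of the quadratic form behind [bellman_form_ge0]. It
    follows from [psi_lb] because [r^3 + 3 r^2 + 6 r + 2] dominates [4 r + 2]. *)
Lemma dpsi_gt_half r : 0 <= r -> 1 < 2 * dpsi r.
Proof.
move=> r0; have := psi_lb r0.
have -> : 2 * dpsi r = psi r * (1 + r) / (2 + r).
  by rewrite /dpsi; field; rewrite gt_eqF//; lra.
rewrite ltr_pdivlMr ?mul1r; last by lra.
set p := psi r; move=> H.
have : (2 + r) * (4 * r + 2) < p * (1 + r) * (4 * r + 2).
  rewrite -mulrA; apply: le_lt_trans H; rewrite ler_wpM2l//; first lra.
  have := exprn_ge0 2 r0; have := exprn_ge0 3 r0; lra.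
by rewrite ltr_pM2r//; lra.
Qed.

(** The discriminant condition for the quadratic form in [a] and [b - r * a] that remains in
    [bellman_form_ge0] when [s] takes its least value [b^2 / r]. *)
Lemma bellman_discr r : 0 <= r ->
  r * (2 * dpsi r) ^+ 2 <= (2 * dpsi r - 1) * (4 * r * ddpsi r + 2 * dpsi r).
Proof.
move=> r0; have B0 : 0 < 2 + r by lra.
have := psi_lb r0; have := psi_gt0 r; rewrite /dpsi /ddpsi.
set p := psi r => p0 H.
rewrite -subr_ge0.
rewrite [leRHS](_ : _ = p * (p * ((1 + r) * (4 * r + 2)) -
  (2 + r) * (r ^+ 3 + 3 * r ^+ 2 + 6 * r + 2)) / (2 + r) ^+ 3).
  by rewrite divr_ge0 ?mulr_ge0// ?exprn_ge0 ?ltW// subr_gt0.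
by field; rewrite gt_eqF.
Qed.

(** The form is the second derivative at [t = 0] of [bell (1 + t a) (r + 2 t b + t^2 (s + a^2))].
    After elimination of [s] and multiplication by [r] and by [k = 2 * dpsi r - 1], the square
    [r (k a - 2 p beta)^2] splits off and [bellman_discr] absorbs the rest. *)
Lemma bellman_form_ge0 r a b s : 0 <= r -> b ^+ 2 <= r * s -> 0 <= s ->
  0 <= - a ^+ 2 + 4 * ddpsi r * (b - r * a) ^+ 2
       + dpsi r * (2 * (s + a ^+ 2) - 8 * a * b + 6 * r * a ^+ 2).
Proof.
move=> r0 brs s0; have := dpsi_gt_half r0; have := bellman_discr r0.
set p := dpsi r; set p' := ddpsi r => D p1.
(* Elimination of [s] needs [r > 0]. At [r = 0] the constraint forces [b = 0], and [2 * dpsi 0 > 1]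
   is enough. *)
have [r00|rn0] := eqVneq r 0.
  have b0 : b = 0.
    by apply/eqP; rewrite -sqrf_eq0 eq_le sqr_ge0 andbT; move: brs; rewrite r00 mul0r.
  by rewrite r00 b0 mul0r; have := sqr_ge0 a; nra.
have rp : 0 < r by rewrite lt_def rn0.
pose beta := b - r * a.
have bE : b = r * a + beta by rewrite /beta; ring.
suff : 0 <= r * (- a ^+ 2 + 4 * p' * (b - r * a) ^+ 2
       + p * (2 * (s + a ^+ 2) - 8 * a * b + 6 * r * a ^+ 2)).
  by rewrite pmulr_rge0.
have p0 : 0 <= p by lra.
have H1 : p * b ^+ 2 <= p * (r * s) by rewrite ler_wpM2l.
apply: (@le_trans _ _ (r * (2 * p - 1) * a ^+ 2 - 4 * r * p * a * beta
  + (4 * r * p' + 2 * p) * beta ^+ 2)); last first.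
  move: H1; rewrite bE; nra.
set k := 2 * p - 1.
have k0 : 0 < k by rewrite /k; lra.
suff : 0 <= k * (r * k * a ^+ 2 - 4 * r * p * a * beta + (4 * r * p' + 2 * p) * beta ^+ 2).
  by rewrite pmulr_rge0.
have H2 : r * (2 * p) ^+ 2 * beta ^+ 2 <= k * (4 * r * p' + 2 * p) * beta ^+ 2.
  by rewrite ler_wpM2r// sqr_ge0.
have : 0 <= r * (k * a - 2 * p * beta) ^+ 2 by rewrite mulr_ge0// sqr_ge0.
lra.
Qed.

Lemma psi_ub s : 0 <= s -> psi (s ^+ 2) <= 10 * (expR (2^-1 * s ^+ 2) * (1 + s)^-1).
Proof.
move=> s0; have B0 : 0 < 2 + s ^+ 2 by nra.
pose q := expR (ln (2 + s ^+ 2) / 2).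
have q0 : 0 < q by exact: expR_gt0.
have qB : q ^+ 2 = 2 + s ^+ 2.
  by rewrite /q -expRM_natl mulrC divfK// lnK// posrE.
rewrite /psi expRD expRN -/q [_^-1 * s ^+ 2]mulrC.
rewrite mulrCA [leRHS]mulrCA ler_wpM2l ?expR_ge0//.
rewrite ler_pdivrMr// mulrAC ler_pdivlMr; last lra.
(* The constants 8 and 10 meet here: the difference of the squares is [9 s^2 - 32 s + 34], which has
   no real root and is least at [s = 16/9]. *)
have : 4 * (1 + s) <= 5 * q.
  rewrite -ler_sqr ?nnegrE; [|lra|lra].
  by rewrite exprMn [leRHS]exprMn qB; have := sqr_ge0 (9 * s - 16); lra.
lra.
Qed.
End bellman.

(** * Approximate convexity of the Bellman function along one step *)

Section bellman_line.
Context {R : realType}.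
Implicit Types r t : R.

Definition bell (x r : R) : R := ln x + psi (r / x ^+ 2).

Lemma psi_le r : 0 <= r -> psi r <= 8 * expR (r / 2).
Proof.
move=> r0; rewrite /psi ler_wpM2l// ler_expR lerBlDr lerDl.
by rewrite divr_ge0// ln_ge0//; lra.
Qed.

Lemma dpsi_bound r M : 0 <= r <= M -> `|dpsi r| <= 8 * expR (M / 2).
Proof.
move=> /andP[r0 rM]; have p0 := psi_gt0 r; rewrite /dpsi normrM (gtr0_norm p0).
apply: (@le_trans _ _ (psi r * 1)).
  rewrite ler_wpM2l//; first exact: ltW.
  by rewrite ger0_norm ?divr_ge0 ?ler_pdivrMr//; lra.
rewrite mulr1; apply: (le_trans (psi_le r0)).
by rewrite ler_wpM2l// ler_expR; lra.
Qed.

Lemma ddpsi_bound r M : 0 <= r <= M -> `|ddpsi r| <= 8 * expR (M / 2).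
Proof.
move=> /andP[r0 rM]; have p0 := psi_gt0 r; rewrite /ddpsi normrM (gtr0_norm p0).
apply: (@le_trans _ _ (psi r * 1)).
  rewrite ler_wpM2l//; first exact: ltW.
  have r2 := sqr_ge0 r.
  by rewrite ger0_norm ?divr_ge0 ?ler_pdivrMr//; nra.
rewrite mulr1; apply: (le_trans (psi_le r0)).
by rewrite ler_wpM2l// ler_expR; lra.
Qed.

Lemma affine_ge_of_endpoints (c a h t : R) : c <= a + h -> c <= a - h ->
  -1 <= t <= 1 -> c <= a + t * h.
Proof.
move=> xp xm /andP[t1 t2].
have H1 : 0 <= (t + 1) * (a + h - c) by rewrite mulr_ge0//; lra.
have H2 : 0 <= (1 - t) * (a - h - c) by rewrite mulr_ge0//; lra.
lra.
Qed.

(** In the application the middle term is [|P + t W|^2 + t^2 h^2] for a weighted scalar product.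
    Only the products [A0], [B0], [C0] are kept, so nonnegativity has to be recovered from
    Cauchy-Schwarz. *)
Lemma sq_radius_bound (h A0 B0 C0 D eps t : R) :
  0 <= D -> 0 <= eps <= 1 -> `|h| <= D * eps ->
  `|B0| <= D * eps -> 0 <= C0 <= D * eps ^+ 2 -> 0 <= A0 <= D ->
  B0 ^+ 2 <= A0 * C0 -> -1 <= t <= 1 ->
  0 <= A0 + 2 * t * B0 + t ^+ 2 * (C0 + h ^+ 2) <= 4 * D + D ^+ 2.
Proof.
move=> D0 eps01 hD BD CD AD CS ht.
have t2 : t ^+ 2 <= 1.
  have : 0 <= (t + 1) * (1 - t) by rewrite mulr_ge0//; lra.
  lra.
have e2 : eps ^+ 2 <= 1.
  have : 0 <= (eps + 1) * (1 - eps) by rewrite mulr_ge0//; lra.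
  lra.
have B1 : `|B0| <= D by apply: (le_trans BD); rewrite ler_piMr//; lra.
have C1 : C0 <= D.
  by case/andP: CD => _ CD2; apply: (le_trans CD2); rewrite ler_piMr//; lra.
have h1 : `|h| <= D by apply: (le_trans hD); rewrite ler_piMr//; lra.
have h2 : h ^+ 2 <= D ^+ 2.
  by rewrite -(@real_normK _ h) ?num_real// lerXn2r ?nnegrE.
have h20 := sqr_ge0 h; have t20 := sqr_ge0 t.
have C00 : 0 <= C0 by lra.
apply/andP; split.
  have : 0 <= t ^+ 2 * h ^+ 2 by rewrite mulr_ge0.
  have : 0 <= A0 + 2 * t * B0 + t ^+ 2 * C0.
    case: (eqVneq C0 0) => [C0E|Cn0].
      have -> : B0 = 0.
        by apply/eqP; rewrite -sqrf_eq0 eq_le sqr_ge0 andbT; move: CS; rewrite C0E mulr0.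
      by rewrite C0E; lra.
    have Cp : 0 < C0 by rewrite lt_def Cn0.
    rewrite -(pmulr_rge0 _ Cp).
    have := sqr_ge0 (B0 + t * C0); lra.
  lra.
have tB : t * B0 <= D.
  apply: (le_trans (ler_norm _)); rewrite normrM -[D]mul1r ler_pM//.
  by rewrite ler_norml.
have tC : t ^+ 2 * (C0 + h ^+ 2) <= D + D ^+ 2.
  by rewrite -[leRHS]mul1r ler_pM//; lra.
lra.
Qed.

(** The value [K1 * (4 * D^2 * Y^2 * K2 + 8 * D^3 * Y^3)], where [K1] bounds [dpsi] and [ddpsi] on
    the range of [rho] and [K2 * eps] bounds [z] in the next proof. *)
Definition defect_cst (D Y : R) :=
  8 * expR ((4 * D + D ^+ 2) * Y ^+ 2 / 2) * (4 * D ^+ 2 * Y ^+ 2 *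
    (4 * D * Y ^+ 2 + 2 * ((4 * D + D ^+ 2) * Y ^+ 2) * D * Y + D ^+ 2 * Y ^+ 2)
    + 8 * D ^+ 3 * Y ^+ 3).

(** If [dr] were [2 * (B0 + t * C0)], this would be [bellman_form_ge0] at the point [t], with no
    defect. The term [t^2 h^2] of [r], which stands for the advance of the clock, perturbs it by
    [e = O(eps^2)], and [e] is always multiplied by a factor [O(eps)]. *)
Lemma bell_second_derivative_ge (h A0 B0 C0 D eps t y Y : R)
  (r := A0 + 2 * t * B0 + t ^+ 2 * (C0 + h ^+ 2))
  (dr := 2 * B0 + 2 * t * (C0 + h ^+ 2))
  (rho := r * y ^+ 2) (drho := dr * y ^+ 2 - 2 * h * (r * y ^+ 3))
  (ddrho := 2 * (C0 + h ^+ 2) * y ^+ 2 - 4 * h * (dr * y ^+ 3)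
            + 6 * h ^+ 2 * (r * y ^+ 4)) :
  0 <= D -> 0 <= eps <= 1 -> `|h| <= D * eps ->
  `|B0| <= D * eps -> 0 <= C0 <= D * eps ^+ 2 -> 0 <= A0 <= D ->
  B0 ^+ 2 <= A0 * C0 -> -1 <= t <= 1 -> 0 < y -> y <= Y ->
  - (defect_cst D Y * eps ^+ 3) <=
  - (h * y) ^+ 2 + (ddpsi rho * drho * drho + dpsi rho * ddrho).
Proof.
move=> D0 eps01 hD BD CD AD CS ht y0 yY.
pose M := (4 * D + D ^+ 2) * Y ^+ 2; pose K1 := 8 * expR (M / 2).
have := sq_radius_bound D0 eps01 hD BD CD AD CS ht.
rewrite -/r => /andP[r0 rM].
have Y0 : 0 < Y by exact: lt_le_trans yY.
have yY2 : `|y ^+ 2| <= Y ^+ 2.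
  by rewrite normrX (gtr0_norm y0) lerXn2r ?nnegrE// ltW.
have p0 : 0 <= rho by rewrite mulr_ge0 ?sqr_ge0.
have pM : rho <= M by rewrite ler_pM ?sqr_ge0// -[leLHS]ger0_norm ?sqr_ge0.
have M0 : 0 <= M by exact: le_trans pM.
have /andP[C00 CM] := CD.
pose al := h * y; pose b0 := (B0 + t * C0) * y ^+ 2.
pose e := t * h ^+ 2 * y ^+ 2; pose s := C0 * y ^+ 2.
have F : 0 <= - al ^+ 2 + 4 * ddpsi rho * (b0 - rho * al) ^+ 2
       + dpsi rho * (2 * (s + al ^+ 2) - 8 * al * b0 + 6 * rho * al ^+ 2).
  (* Cauchy-Schwarz persists along the path: [r * C0 - (B0 + t C0)^2 = A0 C0 - B0^2 + t^2 h^2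
     C0]. *)
  apply: bellman_form_ge0 => //; last by rewrite /s mulr_ge0 ?sqr_ge0.
  rewrite /b0 /s /rho exprMn.
  rewrite (_ : r * _ * _ = r * C0 * (y ^+ 2) ^+ 2); last by ring.
  rewrite ler_wpM2r ?sqr_ge0//.
  have th := mulr_ge0 (mulr_ge0 (sqr_ge0 t) (sqr_ge0 h)) C00.
  rewrite /r; move: CS th; set u := h ^+ 2; lra.
have tn : `|t| <= 1 by rewrite ler_norml.
have h2 : `|h ^+ 2| <= D ^+ 2 * eps ^+ 2.
  by rewrite normrX -exprMn lerXn2r ?nnegrE ?mulr_ge0//; lra.
have eM : `|e| <= D ^+ 2 * Y ^+ 2 * eps ^+ 2.
  by rewrite /e -mulrA normrM -[leRHS]mul1r ler_pM// normrM mulrAC ler_pM.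
have alM : `|al| <= D * Y * eps.
  by rewrite /al normrM mulrAC ler_pM// gtr0_norm.
have e2e : eps ^+ 2 <= eps by clear -eps01; nra.
have b0M : `|b0| <= 2 * D * Y ^+ 2 * eps.
  rewrite /b0 normrM mulrAC ler_pM//.
  apply: (le_trans (ler_normD _ _)); rewrite normrM (ger0_norm C00).
  have : `|t| * C0 <= D * eps ^+ 2 by rewrite -[leRHS]mul1r ler_pM.
  have : D * eps ^+ 2 <= D * eps by rewrite ler_wpM2l.
  by clear -BD; lra.
have pe : `|rho| <= M by rewrite ger0_norm.
pose z := 2 * (b0 - rho * al) + e.
pose K2 := 4 * D * Y ^+ 2 + 2 * M * D * Y + D ^+ 2 * Y ^+ 2.
have zM : `|z| <= K2 * eps.
  apply: (le_trans (ler_normD _ _)); rewrite normrM (ger0_norm (_ : 0 <= 2))//.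
  have H1 : `|b0 - rho * al| <= 2 * D * Y ^+ 2 * eps + M * (D * Y * eps).
    by apply: (le_trans (ler_normB _ _)); rewrite lerD// normrM ler_pM.
  have H2 : `|e| <= D ^+ 2 * Y ^+ 2 * eps.
    by apply: (le_trans eM); rewrite ler_wpM2l// mulr_ge0 ?sqr_ge0.
  by rewrite /K2; clear -H1 H2; lra.
have -> : - (h * y) ^+ 2 + (ddpsi rho * drho * drho + dpsi rho * ddrho) =
       (- al ^+ 2 + 4 * ddpsi rho * (b0 - rho * al) ^+ 2
       + dpsi rho * (2 * (s + al ^+ 2) - 8 * al * b0 + 6 * rho * al ^+ 2))
       + (4 * (ddpsi rho * (e * z)) - 8 * (dpsi rho * (al * e))).
  have -> : drho = 2 * (b0 + e - rho * al).
    by rewrite /drho /dr /b0 /e /al /rho; ring.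
  have -> : ddrho = 2 * (s + al ^+ 2) - 8 * al * (b0 + e) + 6 * rho * al ^+ 2.
    by rewrite /ddrho /dr /b0 /e /al /rho /s; ring.
  by rewrite /z -[h * y]/al; clearbody al b0 e s rho; ring.
rewrite -[leLHS]add0r lerD//.
have P1 : `|dpsi rho| <= K1 by apply: dpsi_bound; rewrite p0 pM.
have P2 : `|ddpsi rho| <= K1 by apply: ddpsi_bound; rewrite p0 pM.
apply: lerNnormlW.
apply: (le_trans (ler_normB _ _)).
rewrite (normrM 4) (normrM 8) (normrM (ddpsi _)) (normrM e) (normrM (dpsi _)) (normrM al).
rewrite (ger0_norm (_ : 0 <= 4))// (ger0_norm (_ : 0 <= 8))//.
have X1 : `|ddpsi rho| * (`|e| * `|z|) <= K1 * ((D ^+ 2 * Y ^+ 2 * eps ^+ 2) * (K2 * eps)).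
  by rewrite ler_pM ?mulr_ge0// ler_pM.
have X2 : `|dpsi rho| * (`|al| * `|e|) <= K1 * ((D * Y * eps) * (D ^+ 2 * Y ^+ 2 * eps ^+ 2)).
  by rewrite ler_pM ?mulr_ge0// ler_pM.
rewrite /defect_cst -/M -/K2 -/K1.
move: X1 X2; move: (`|ddpsi _| * _) (`|dpsi _| * _) => u v.
by clear; clearbody K1 K2; lra.
Qed.

Section line.
Variables (a h A0 B0 C0 : R).
Let x (t : R) := a + t * h.
Let y (t : R) := (a + t * h)^-1.
Let rr (t : R) := A0 + 2 * t * B0 + t ^+ 2 * (C0 + h ^+ 2).
Let drr (t : R) := 2 * B0 + 2 * t * (C0 + h ^+ 2).
Let rho (t : R) := rr t * y t ^+ 2.
Let drho (t : R) := drr t * y t ^+ 2 - 2 * h * (rr t * y t ^+ 3).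
Let ddrho (t : R) := 2 * (C0 + h ^+ 2) * y t ^+ 2 - 4 * h * (drr t * y t ^+ 3)
  + 6 * h ^+ 2 * (rr t * y t ^+ 4).
Let E (t : R) := ln (x t) + psi (rho t).
Let dE (t : R) := h * y t + dpsi (rho t) * drho t.
Let ddE (t : R) := - (h * y t) ^+ 2 + (ddpsi (rho t) * drho t * drho t + dpsi (rho t) * ddrho t).

Let derx t : is_derive t 1 x h.
Proof. by rewrite /x; apply: is_derive_eq; rewrite /GRing.scale /=; ring. Qed.

Let dery t : 0 < x t -> is_derive t 1 y (- h * y t ^+ 2).
Proof.
move=> x0; have H := derx t.
have -> : - h * y t ^+ 2 = - (x t) ^- 2 * h by rewrite /y exprVn; ring.
by apply: is_deriveV => //; rewrite gt_eqF.
Qed.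

Let derrr t : is_derive t 1 rr (drr t).
Proof. by rewrite /rr /drr; apply: is_derive_eq; rewrite /GRing.scale /=; ring. Qed.

Let derdrr t : is_derive t 1 drr (2 * (C0 + h ^+ 2)).
Proof. by rewrite /drr; apply: is_derive_eq; rewrite /GRing.scale /=; ring. Qed.

Let derrho t : 0 < x t -> is_derive t 1 rho (drho t).
Proof.
move=> x0; have H1 := dery x0; have H2 := derrr t.
rewrite /rho /drho; apply: is_derive_eq; rewrite /GRing.scale /=; ring.
Qed.

Let derdrho t : 0 < x t -> is_derive t 1 drho (ddrho t).
Proof.
move=> x0; have H1 := dery x0; have H2 := derrr t; have H3 := derdrr t.
rewrite /drho /ddrho; apply: is_derive_eq; rewrite /GRing.scale /=; ring.
Qed.

Let derE t : 0 < x t -> 0 <= rho t -> is_derive t 1 E (dE t).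
Proof.
move=> x0 r0; have H1 := derrho x0; have H2 := derx t.
have H3 := is_derive_psi r0; have H4 := is_derive1_ln x0.
have H5 : is_derive t 1 (psi \o rho) (dpsi (rho t) * drho t) by apply: is_derive1_comp.
have H6 : is_derive t 1 (@ln R \o x) ((x t)^-1 * h) by apply: is_derive1_comp.
by rewrite /dE mulrC; apply: is_deriveD.
Qed.

Let derdE t : 0 < x t -> 0 <= rho t -> is_derive t 1 dE (ddE t).
Proof.
move=> x0 r0; have H1 := derrho x0; have H2 := dery x0; have H3 := derdrho x0.
have H4 := is_derive_dpsi r0.
have H5 : is_derive t 1 (dpsi \o rho) (ddpsi (rho t) * drho t) by apply: is_derive1_comp.
have -> : dE = (h *: y) + (dpsi \o rho) * drho by [].
have Q1 := is_deriveZ h H2; have Q2 := is_deriveM H5 H3.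
have Q3 := is_deriveD Q1 Q2; apply: is_derive_eq Q3 _.
rewrite /ddE /GRing.scale /=.
by move: (drho t) (ddrho t) (y t) (dpsi _) (ddpsi _) => *; ring.
Qed.

Lemma bell_two_point_line (c D eps : R) : 0 < c -> 0 <= D -> 0 <= eps <= 1 ->
  c <= a + h -> c <= a - h -> `|h| <= D * eps -> `|B0| <= D * eps ->
  0 <= C0 <= D * eps ^+ 2 -> 0 <= A0 <= D -> B0 ^+ 2 <= A0 * C0 ->
  2 * bell a A0 - 2 * (defect_cst D c^-1 * eps ^+ 3) <=
  bell (a + h) (A0 + 2 * B0 + C0 + h ^+ 2) + bell (a - h) (A0 - 2 * B0 + C0 + h ^+ 2).
Proof.
move=> c0 D0 eps01 xp xm hD BD CD AD CS.
have xc t : -1 <= t <= 1 -> c <= x t by exact: affine_ge_of_endpoints.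
have xt t : -1 <= t <= 1 -> 0 < x t by move=> /xc; exact: lt_le_trans.
have rt t : -1 <= t <= 1 -> 0 <= rho t.
  move=> ht; rewrite mulr_ge0 ?sqr_ge0//.
  by have /andP[] := sq_radius_bound D0 eps01 hD BD CD AD CS ht.
have lb t : -1 <= t <= 1 -> - (defect_cst D c^-1 * eps ^+ 3) <= ddE t.
  move=> ht; apply: bell_second_derivative_ge => //.
    by rewrite invr_gt0 xt.
  by rewrite lef_pV2 ?posrE ?xt// xc.
have Y0 : 0 <= c^-1 by rewrite invr_ge0 ltW.
have K0 : 0 <= defect_cst D c^-1 * eps ^+ 3.
  rewrite mulr_ge0 ?exprn_ge0//; last lra.
  by rewrite mulr_ge0 ?mulr_ge0 ?expR_ge0// ?addr_ge0 ?mulr_ge0 ?addr_ge0 ?mulr_ge0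
    ?addr_ge0 ?mulr_ge0 ?sqr_ge0 ?exprn_ge0.
have := midpoint_convex_defect (fun t ht => derE (xt t ht) (rt t ht))
  (fun t ht => derdE (xt t ht) (rt t ht)) lb K0.
rewrite /E /x /rho /rr /y /bell; congr (_ <= _).
  by rewrite mul0r addr0 mulr0 mul0r expr0n/= mul0r !addr0 exprVn.
rewrite !mul1r !mulN1r !exprVn !mulr1 expr1n sqrrN expr1n.
by rewrite !mul1r mulrN1 mulNr !addrA.
Qed.

End line.
End bellman_line.

(* [a], [A0] are the mean of [u] and the square of the mean of its gradient over the
   two endpoints of a step, [h] and [C0] the half-difference of [u] and the square of
   the half-difference of its gradient, [B0] the scalar product of these two vectors. *)
Lemma bell_two_point {R : realType} (c D : R) : 0 < c -> 0 <= D ->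
  exists2 K, 0 <= K & forall eps a h A0 B0 C0 : R, 0 <= eps <= 1 ->
  c <= a + h -> c <= a - h -> `|h| <= D * eps -> `|B0| <= D * eps ->
  0 <= C0 <= D * eps ^+ 2 -> 0 <= A0 <= D -> B0 ^+ 2 <= A0 * C0 ->
  2 * bell a A0 - 2 * (K * eps ^+ 3) <=
  bell (a + h) (A0 + 2 * B0 + C0 + h ^+ 2) + bell (a - h) (A0 - 2 * B0 + C0 + h ^+ 2).
Proof.
move=> c0 D0; eexists; last first.
  move=> eps a h A0 B0 C0 e01 h1 h2 h3 h4 h5 h6 h7.
  exact: (bell_two_point_line c0 D0 e01 h1 h2 h3 h4 h5 h6 h7).
have Y0 : 0 <= c^-1 by rewrite invr_ge0 ltW.
by rewrite mulr_ge0 ?mulr_ge0 ?expR_ge0// ?addr_ge0 ?mulr_ge0 ?addr_ge0 ?mulr_ge0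
    ?addr_ge0 ?mulr_ge0 ?sqr_ge0 ?exprn_ge0.
Qed.

(** Needed to exchange [h^2] for [eps^2] times the squared partial derivative at an endpoint of a
    step. *)
Lemma bell_lipschitz {R : realType} (c D : R) : 0 < c -> 0 <= D ->
  exists2 K, 0 <= K & forall x r s, c <= x -> 0 <= r <= D -> 0 <= s <= D ->
   `|bell x r - bell x s| <= K * `|r - s|.
Proof.
move=> c0 D0; pose M := D / c ^+ 2.
exists (8 * expR (M / 2) / c ^+ 2) => [|x r s xc].
  by rewrite divr_ge0 ?sqr_ge0 // mulr_ge0 ?expR_ge0.
have x0 : 0 < x by exact: lt_le_trans xc.
wlog rs : r s / r <= s => [H rD sD|].
  by case/orP: (le_total r s) => ?; last rewrite distrC (distrC r); exact: H.
move=> rD sD.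
have c2 : 0 < c ^+ 2 by rewrite exprn_gt0.
have x2 : 0 < x ^+ 2 by rewrite exprn_gt0.
have cx2 : c ^+ 2 <= x ^+ 2 by rewrite lerXn2r// nnegrE ltW.
have sM : s / x ^+ 2 <= M.
  have /andP[s0 sD'] := sD.
  by rewrite /M ler_pM// ?invr_ge0 ?(ltW x2)// lef_pV2.
have rs2 : r / x ^+ 2 <= s / x ^+ 2 by rewrite ler_pM2r ?invr_gt0.
have r0 : 0 <= r / x ^+ 2 by rewrite divr_ge0 ?(ltW x2)//; case/andP: rD.
have -> : bell x r - bell x s = psi (r / x ^+ 2) - psi (s / x ^+ 2).
  by rewrite /bell; ring.
rewrite distrC (distrC r).
apply: le_trans (@lipschitz_of_derive_bound _ psi dpsi _ _ (8 * expR (M / 2)) rs2 _ _) _.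
- by move=> z /andP[hz _]; apply: is_derive_psi; exact: le_trans hz.
- by move=> z /andP[hz hz']; apply: dpsi_bound; rewrite (le_trans r0 hz) (le_trans hz').
rewrite -mulrBl ger0_norm ?subr_ge0// mulrA mulrAC ler_wpM2r ?subr_ge0//.
by rewrite ler_wpM2l ?mulr_ge0 ?expR_ge0// lef_pV2.
Qed.

(** * Random walks with steps along the axes *)

Lemma weighted_cauchy_schwarz {R : realFieldType} (I : finType) (t a b : I -> R) :
  (forall i, 0 <= t i) ->
  (\sum_i t i * (a i * b i)) ^+ 2 <=
  (\sum_i t i * a i ^+ 2) * (\sum_i t i * b i ^+ 2).
Proof.
move=> t0; set A := \sum_i t i * a i ^+ 2; set C := \sum_i t i * b i ^+ 2.
set B := \sum_i _.
have quad l : 0 <= A - 2 * l * B + l ^+ 2 * C.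
  have -> : A - 2 * l * B + l ^+ 2 * C = \sum_i t i * (a i - l * b i) ^+ 2.
    rewrite !mulr_sumr -sumrB -big_split/=; apply: eq_bigr => i _; ring.
  by apply: sumr_ge0 => i _; rewrite mulr_ge0 ?sqr_ge0.
have C0 : 0 <= C by apply: sumr_ge0 => i _; rewrite mulr_ge0 ?sqr_ge0.
have [CE|Cn0] := eqVneq C 0.
  have [->|Bn0] := eqVneq B 0; first by rewrite expr0n/= CE mulr0.
  have := quad ((A + 1) / (2 * B)); rewrite CE mulr0 addr0.
  suff -> : A - 2 * ((A + 1) / (2 * B)) * B = -1 by rewrite ler0N1.
  by field.
have Cp : 0 < C by rewrite lt_def Cn0.
have := quad (B / C).
have -> : A - 2 * (B / C) * B + (B / C) ^+ 2 * C = (A * C - B ^+ 2) / C by field.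
by rewrite pmulr_lge0 ?invr_gt0// subr_ge0.
Qed.

Section walk.
Context {R : realType} {n : nat}.
Implicit Types (phi u : 'rV[R]_n -> R) (x : 'rV[R]_n) (i j : 'I_n) (eps : R).

Definition unit_vec i : 'rV[R]_n := delta_mx ord0 i.

Definition avg eps i phi x :=
  (phi (x + eps *: unit_vec i) + phi (x - eps *: unit_vec i)) / 2.

Definition half_diff eps i phi x :=
  (phi (x + eps *: unit_vec i) - phi (x - eps *: unit_vec i)) / 2.

Definition walk eps (ds : seq 'I_n) phi := foldr (avg eps) phi ds.

Lemma avg_plus eps i phi x :
  avg eps i phi x + half_diff eps i phi x = phi (x + eps *: unit_vec i).
Proof. by rewrite /avg /half_diff; lra. Qed.

Lemma avg_minus eps i phi x :
  avg eps i phi x - half_diff eps i phi x = phi (x - eps *: unit_vec i).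
Proof. by rewrite /avg /half_diff; lra. Qed.

Lemma le_avg eps i phi xi x : (forall y, phi y <= xi y) ->
  avg eps i phi x <= avg eps i xi x.
Proof.
move=> H; rewrite /avg.
have := H (x + eps *: unit_vec i); have := H (x - eps *: unit_vec i); lra.
Qed.

Lemma avg_cst eps i (c : R) x : avg eps i (cst c) x = c.
Proof. by rewrite /avg/=; lra. Qed.

Lemma norm_avg_le eps i phi (C : R) x : (forall y, `|phi y| <= C) ->
  `|avg eps i phi x| <= C.
Proof.
move=> H; rewrite ler_norml -{1}(avg_cst eps i (- C) x) -{2}(avg_cst eps i C x).
by rewrite !le_avg// => y; have := H y; rewrite ler_norml => /andP[].
Qed.

Lemma avgD eps i phi u x :
  avg eps i (fun y => phi y + u y) x = avg eps i phi x + avg eps i u x.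
Proof. by rewrite /avg; lra. Qed.

Lemma shiftC (a b : R) i j x : x + a *: unit_vec i + b *: unit_vec j =
  x + b *: unit_vec j + a *: unit_vec i.
Proof. by rewrite addrAC. Qed.

Lemma half_diff_avg eps i d phi x :
  half_diff eps i (avg eps d phi) x = avg eps d (half_diff eps i phi) x.
Proof.
rewrite /half_diff /avg -!(scaleNr _ (unit_vec _)).
rewrite !(shiftC _ _ d i); lra.
Qed.

(* [p] plays the role of [grad u]. Difference quotients at scale [eps] replace
   derivatives, so that averaging trivially preserves the class. *)
Record walk_class (c C eps : R) u (p : 'I_n -> 'rV[R]_n -> R) : Prop := WalkClass {
  wc_ge : forall x, c <= u x ;
  wc_grad : forall j x, `|p j x| <= C ;
  wc_diff : forall i x, `|half_diff eps i u x| <= C * eps ;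
  wc_diff_grad : forall i j x, `|half_diff eps i (p j) x| <= C * eps ;
  wc_plus : forall i x,
    `|half_diff eps i u x - eps * p i (x + eps *: unit_vec i)| <= C * eps ^+ 2 ;
  wc_minus : forall i x,
    `|half_diff eps i u x - eps * p i (x - eps *: unit_vec i)| <= C * eps ^+ 2 }.

Lemma walk_class_avg (c C eps : R) u p d : walk_class c C eps u p ->
  walk_class c C eps (avg eps d u) (fun j => avg eps d (p j)).
Proof.
move=> [H1 H2 H3 H4 H5 H6]; split.
- by move=> x; rewrite -(avg_cst eps d c x); apply: le_avg.
- by move=> j x; apply: norm_avg_le.
- by move=> i x; rewrite half_diff_avg; apply: norm_avg_le.
- by move=> i j x; rewrite half_diff_avg; apply: norm_avg_le.
- move=> i x; rewrite half_diff_avg.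
  have -> : avg eps d (half_diff eps i u) x - eps * avg eps d (p i) (x + eps *: unit_vec i) =
     avg eps d (fun y => half_diff eps i u y - eps * p i (y + eps *: unit_vec i)) x.
    rewrite /avg -!(scaleNr _ (unit_vec _)) !(shiftC _ _ d i); lra.
  exact: norm_avg_le.
- move=> i x; rewrite half_diff_avg.
  have -> : avg eps d (half_diff eps i u) x - eps * avg eps d (p i) (x - eps *: unit_vec i) =
     avg eps d (fun y => half_diff eps i u y - eps * p i (y - eps *: unit_vec i)) x.
    rewrite /avg -!(scaleNr _ (unit_vec _)) !(shiftC _ _ d i); lra.
  exact: norm_avg_le.
Qed.

Lemma walk_class_walk (c C eps : R) u p ds : walk_class c C eps u p ->
  walk_class c C eps (walk eps ds u) (fun j => walk eps ds (p j)).
Proof. by move=> H; elim: ds => //= d ds; apply: walk_class_avg. Qed.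

Lemma sum_weight_le (t a : 'I_n -> R) (M : R) :
  (forall j, 0 <= t j <= 1) -> (forall j, `|a j| <= M) ->
  `|\sum_j t j * a j| <= n%:R * M.
Proof.
move=> t01 aM; apply: (le_trans (ler_norm_sum _ _ _)).
have -> : n%:R * M = \sum_(j < n) M by rewrite sumr_const card_ord mulr_natl.
apply: ler_sum => j _.
have /andP[t0 t1] := t01 j.
rewrite normrM (ger0_norm t0) -[leRHS]mul1r.
by rewrite ler_pM.
Qed.

(** [bell_two_point] produces the second argument at both endpoints, except that it contains [h^2]
    where the advanced clock requires [eps^2 * p i ^ 2]. The difference of these squares has a
    factor [h - eps * p i = O(eps^2)], by [wc_plus] and [wc_minus], and a factor [O(eps)]. *)
Lemma bell_walk_step (c C : R) : 0 < c -> 0 <= C ->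
  exists2 K, 0 <= K & forall eps u p (t : 'I_n -> R) i x,
  0 <= eps <= 1 -> walk_class c C eps u p -> (forall j, 0 <= t j <= 1) ->
  bell (avg eps i u x) (\sum_j t j * avg eps i (p j) x ^+ 2) <=
  avg eps i (fun y => bell (u y) (\sum_j (t j + eps ^+ 2 * (j == i)%:R) * p j y ^+ 2)) x
   + K * eps ^+ 3.
Proof.
move=> c0 C0; have n0 : 0 <= n%:R :> R by [].
(* One constant for all the bounds: [n C^2] for the weighted sums, one more [C^2] for the added
   [h^2], and [C] for [h] itself. *)
pose D := n%:R * C ^+ 2 + C ^+ 2 + C.
have C2 : 0 <= C ^+ 2 by rewrite sqr_ge0.
have nC2 : 0 <= n%:R * C ^+ 2 by rewrite mulr_ge0.
have D0 : 0 <= D by rewrite /D; lra.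
have nCD : n%:R * C ^+ 2 <= D by rewrite /D; lra.
have CD : C <= D by rewrite /D; lra.
have nCCD : n%:R * C ^+ 2 + C ^+ 2 <= D by rewrite /D; lra.
have [K1 K10 two] := bell_two_point c0 D0.
have [K2 K20 lip] := bell_lipschitz c0 D0.
exists (K1 + K2 * (2 * C ^+ 2)) => [|eps u p t i x e01 wc t01].
  by rewrite addr_ge0// !mulr_ge0.
have /andP[e0 e1] := e01.
have e21 : eps ^+ 2 <= 1 by rewrite expr_le1.
have e20 : 0 <= eps ^+ 2 by rewrite sqr_ge0.
have Ce0 : 0 <= C * eps by rewrite mulr_ge0.
have e2e : eps ^+ 2 <= eps by rewrite -[leRHS]mul1r expr2 ler_wpM2r.
pose a := avg eps i u x; pose h := half_diff eps i u x.
pose P j := avg eps i (p j) x; pose W j := half_diff eps i (p j) x.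
pose A0 := \sum_j t j * P j ^+ 2; pose B0 := \sum_j t j * (P j * W j).
pose C1 := \sum_j t j * W j ^+ 2.
have PC j : `|P j| <= C by apply: norm_avg_le => y; exact: (wc_grad wc).
have WC j : `|W j| <= C * eps by exact: (wc_diff_grad wc).
have hC : `|h| <= C * eps by exact: (wc_diff wc).
have t0 j : 0 <= t j by have /andP[] := t01 j.
have sqC (z : R) : `|z| <= C -> `|z ^+ 2| <= C ^+ 2.
  by move=> zC; rewrite normrX lerXn2r ?nnegrE.
have sqCe (z : R) : `|z| <= C * eps -> `|z ^+ 2| <= C ^+ 2 * eps ^+ 2.
  by move=> zC; rewrite normrX -exprMn lerXn2r ?nnegrE.
have xp : u (x + eps *: unit_vec i) = a + h by rewrite avg_plus.
have xm : u (x - eps *: unit_vec i) = a - h by rewrite avg_minus.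
have Ep : \sum_j t j * p j (x + eps *: unit_vec i) ^+ 2 = A0 + 2 * B0 + C1.
  rewrite /A0 /B0 /C1 mulr_sumr -!big_split/=; apply: eq_bigr => j _.
  by rewrite -avg_plus -/(P j) -/(W j); ring.
have Em : \sum_j t j * p j (x - eps *: unit_vec i) ^+ 2 = A0 - 2 * B0 + C1.
  rewrite /A0 /B0 /C1 mulr_sumr -sumrB -!big_split/=; apply: eq_bigr => j _.
  by rewrite -avg_minus -/(P j) -/(W j); ring.
have hc : h ^+ 2 <= C ^+ 2 * eps ^+ 2.
  by rewrite -[leLHS]ger0_norm ?sqr_ge0// sqCe.
have Ce2 : C ^+ 2 * eps ^+ 2 <= C ^+ 2 by rewrite ler_piMr.
have A0b : 0 <= A0 <= n%:R * C ^+ 2.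
  rewrite sumr_ge0/= => [|j _]; last by rewrite mulr_ge0 ?sqr_ge0.
  by apply: (le_trans (ler_norm _)); apply: sum_weight_le => // j; apply: sqC.
have C1b : 0 <= C1 <= n%:R * C ^+ 2 * eps ^+ 2.
  rewrite sumr_ge0/= => [|j _]; last by rewrite mulr_ge0 ?sqr_ge0.
  rewrite -mulrA; apply: (le_trans (ler_norm _)).
  by apply: sum_weight_le => // j; apply: sqCe.
have B0b : `|B0| <= n%:R * C ^+ 2 * eps.
  rewrite -mulrA; apply: sum_weight_le => // j.
  by rewrite normrM expr2 -mulrA ler_pM.
have De : n%:R * C ^+ 2 * eps <= D * eps by rewrite ler_wpM2r.
have De2 : n%:R * C ^+ 2 * eps ^+ 2 <= D * eps ^+ 2 by rewrite ler_wpM2r.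
have DC : C * eps <= D * eps by rewrite ler_wpM2r.
have CS : B0 ^+ 2 <= A0 * C1 by exact: weighted_cauchy_schwarz.
have main : 2 * bell a A0 - 2 * (K1 * eps ^+ 3) <=
    bell (a + h) (A0 + 2 * B0 + C1 + h ^+ 2) + bell (a - h) (A0 - 2 * B0 + C1 + h ^+ 2).
  apply: two => //.
  - by rewrite -xp; exact: (wc_ge wc).
  - by rewrite -xm; exact: (wc_ge wc).
  - exact: le_trans DC.
  - exact: le_trans De.
  - by have /andP[-> /= C1b'] := C1b; exact: le_trans De2.
  - by have /andP[-> /= A0b'] := A0b; exact: le_trans nCD.
have comp (s z : R) y : c <= u y -> s = \sum_j t j * p j y ^+ 2 ->
    `|p i y| <= C -> `|h - eps * p i y| <= C * eps ^+ 2 ->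
    bell (u y) (s + h ^+ 2) <= bell (u y) (\sum_j (t j + eps ^+ 2 * (j == i)%:R) * p j y ^+ 2)
      + K2 * (2 * C ^+ 2) * eps ^+ 3.
  move=> cu sE pC hp.
  have -> : \sum_j (t j + eps ^+ 2 * (j == i)%:R) * p j y ^+ 2 = s + eps ^+ 2 * p i y ^+ 2.
    under eq_bigr do rewrite mulrDl; rewrite big_split/= -sE; congr (_ + _).
    rewrite (bigD1 i)//= eqxx mulr1 big1 ?addr0// => j /negbTE ->.
    by rewrite mulr0 mul0r.
  have s0 : 0 <= s <= n%:R * C ^+ 2.
    rewrite sE sumr_ge0/= => [|j _]; last by rewrite mulr_ge0 ?sqr_ge0.
    apply: (le_trans (ler_norm _)); apply: sum_weight_le => // j.
    by apply: sqC; exact: (wc_grad wc).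
  have p2 : 0 <= eps ^+ 2 * p i y ^+ 2 <= C ^+ 2.
    rewrite mulr_ge0 ?sqr_ge0//= -[leRHS]mul1r ler_pM ?sqr_ge0//.
    by rewrite -[leLHS]ger0_norm ?sqr_ge0// sqC.
  have h2 := sqr_ge0 h.
  rewrite -lerBlDl; apply: (le_trans (ler_norm _)).
  apply: (le_trans (lip _ _ _ cu _ _)); [clear -s0 h2 hc Ce2 nCCD; lra|clear -s0 p2 nCCD; lra|].
  rewrite -mulrA ler_wpM2l//.
  have -> : s + h ^+ 2 - (s + eps ^+ 2 * p i y ^+ 2) =
    (h - eps * p i y) * (h + eps * p i y) by ring.
  rewrite normrM.
  have -> : 2 * C ^+ 2 * eps ^+ 3 = (C * eps ^+ 2) * (C * eps + C * eps) by ring.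
  rewrite ler_pM// (le_trans (ler_normD _ _))// lerD//.
  by rewrite normrM (ger0_norm e0) mulrC ler_wpM2r.
rewrite -/a -/A0 {1}/avg.
have Hp := comp _ 0 _ (wc_ge wc (x + eps *: unit_vec i)) (esym Ep)
  (wc_grad wc _ _) (wc_plus wc i x).
have Hm := comp _ 0 _ (wc_ge wc (x - eps *: unit_vec i)) (esym Em)
  (wc_grad wc _ _) (wc_minus wc i x).
move: main Hp Hm; rewrite -{1}xp -{1}xm.
move: (bell (u _) (\sum_j _)) (bell (u _) (\sum_j _)) (bell (u _) _) (bell (u _) _)
  (bell a A0) => b1 b2 b3 b4 b5.
by clear; move=> main Hp Hm; lra.
Qed.

(** The induction is over all clocks [t]: the head of [ds] is the outermost average, hence the first
    step, and the rest of the walk starts from the clock that it has advanced. *)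
Lemma bell_walk (c C : R) : 0 < c -> 0 <= C ->
  exists2 K, 0 <= K & forall eps (ds : seq 'I_n) u p (t : 'I_n -> R) x,
  0 <= eps <= 1 -> walk_class c C eps u p ->
  (forall j, 0 <= t j) -> (forall j, t j + eps ^+ 2 * (count_mem j ds)%:R <= 1) ->
  bell (walk eps ds u x) (\sum_j t j * walk eps ds (p j) x ^+ 2) <=
  walk eps ds (fun y => bell (u y)
    (\sum_j (t j + eps ^+ 2 * (count_mem j ds)%:R) * p j y ^+ 2)) x
   + (size ds)%:R * (K * eps ^+ 3).
Proof.
move=> c0 C0; have [K K0 step] := bell_walk_step c0 C0; exists K => //.
move=> eps ds u p t x e01 wc; elim: ds t x => [|d ds IH] t x t0 t1 /=.
  rewrite mul0r addr0; under [in leRHS]eq_bigr do rewrite mulr0 addr0.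
  by [].
have e2 : 0 <= eps ^+ 2 by rewrite sqr_ge0.
have t1' j : t j + eps ^+ 2 * (j == d)%:R + eps ^+ 2 * (count_mem j ds)%:R <= 1.
  by have := t1 j; rewrite /= natrD eq_sym mulrDr addrA.
have t01 j : 0 <= t j <= 1.
  rewrite t0/=; apply: le_trans (t1 j); rewrite lerDl mulr_ge0//.
apply: (le_trans (step _ _ _ _ _ _ e01 (walk_class_walk ds wc) t01)).
rewrite -natr1 mulrDl mul1r addrA lerD2r.
have := @le_avg eps d _ _ x (fun y => IH (fun j => t j + eps ^+ 2 * (j == d)%:R) y _ t1').
move/(_ (fun j => addr_ge0 (t0 j) (mulr_ge0 e2 (ler0n _ _)))).
rewrite avgD avg_cst => /le_trans; apply; rewrite lerD2r.
rewrite le_eqVlt; apply/orP; left; apply/eqP.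
congr (avg eps d (walk eps ds _) x); apply/funext => y; congr bell.
by apply: eq_bigr => j _; rewrite -addrA -mulrDr -natrD [d == j]eq_sym.
Qed.
End walk.

(** * The central limit theorem on the line *)

Section real_calculus.
Context {R : realType}.

Lemma mean_value_any {f df : R -> R} (x y : R) :
  (forall z : R, is_derive z 1 f (df z)) ->
  exists2 c, `|c - x| <= `|y - x| & f y - f x = df c * (y - x).
Proof.
move=> fdf; case: (lerP x y) => [xy|/ltW yx].
  have [c cxy E] := mean_value xy (fun z _ => fdf z).
  by exists c => //; rewrite !ger0_norm; lra.
have [c cxy E] := mean_value yx (fun z _ => fdf z).
exists c; last by rewrite -opprB E -mulrN opprB.
by rewrite !ler0_norm; lra.
Qed.

Lemma is_derive_affine {f df : R -> R} (a b z : R) :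
  (forall z : R, is_derive z 1 f (df z)) ->
  is_derive z 1 (fun t => f (a * t + b)) (a * df (a * z + b)).
Proof.
move=> fdf.
have H : is_derive z 1 (fun t : R => a * t + b) a.
  by apply: is_derive_eq; rewrite /GRing.scale /=; ring.
have := @is_derive1_comp _ f (fun t => a * t + b) _ _ _ (fdf _) H.
by rewrite mulrC.
Qed.

Lemma taylor_order2 {h h1 h2 : R -> R} (M x t : R) :
  (forall z : R, is_derive z 1 h (h1 z)) ->
  (forall z : R, is_derive z 1 h1 (h2 z)) ->
  (forall z : R, `|h2 z| <= M) ->
  `|h (x + t) - h x - t * h1 x| <= M * t ^+ 2.
Proof.
move=> H1 H2 hM.
have [c cx ->] := mean_value_any x (x + t) H1.
have -> : x + t - x = t by ring.
have [d dx E] := mean_value_any x c H2.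
rewrite mulrC -mulrBr normrM E normrM -[t ^+ 2]real_normK ?num_real// expr2.
rewrite mulrCA ler_pM// ler_wpM2l//.
by apply: (le_trans cx); rewrite addrAC subrr add0r.
Qed.

(** Once the quadratic model is subtracted, the derivative of the symmetrised function at [t] is
    [2 t] times an increment of [h2]. A modulus of continuity of [h2] thus replaces a bound on a
    third derivative. *)
Lemma second_difference {h h1 h2 : R -> R} (eta eps x : R) : 0 <= eps ->
  (forall z : R, is_derive z 1 h (h1 z)) ->
  (forall z : R, is_derive z 1 h1 (h2 z)) ->
  (forall t : R, `|t| <= eps -> `|h2 (x + t) - h2 x| <= eta) ->
  `|(h (x + eps) + h (x - eps)) / 2 - h x - eps ^+ 2 / 2 * h2 x| <= eps ^+ 2 * eta.
Proof.
move=> e0 H1 H2 osc.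
pose k t := h (1 * t + x) + h (-1 * t + x) - t ^+ 2 * h2 x.
pose dk t := 1 * h1 (1 * t + x) + -1 * h1 (-1 * t + x) - 2 * t * h2 x.
have kdk (t : R) : is_derive t 1 k (dk t).
  have A1 := is_derive_affine 1 x t H1; have A2 := is_derive_affine (-1) x t H1.
  rewrite /k /dk; apply: is_derive_eq; rewrite /GRing.scale /=; ring.
have eta0 : 0 <= eta.
  by have := osc 0; rewrite normr0 addr0 subrr normr0; apply.
have B (t : R) : 0 <= t <= eps -> `|dk t| <= 2 * eps * eta.
  move=> /andP[t0 te].
  have tx : -1 * t + x <= 1 * t + x by lra.
  have [c cx E] := mean_value tx (fun z _ => H2 z).
  have -> : dk t = 2 * t * (h2 (x + (c - x)) - h2 x).
    rewrite (_ : x + (c - x) = c); last by ring.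
    by rewrite /dk mul1r mulN1r E; ring.
  have t20 : 0 <= 2 * t by lra.
  rewrite normrM (ger0_norm t20) ler_pM//; first lra.
  by apply: osc; rewrite ler_norml; lra.
have := @lipschitz_of_derive_bound _ k dk 0 eps (2 * eps * eta) e0 (fun t _ => kdk t) B.
have -> : k eps = h (x + eps) + h (x - eps) - eps ^+ 2 * h2 x.
  by rewrite /k mul1r mulN1r ![_ + x]addrC.
have -> : k 0 = h x + h x by rewrite /k !mulr0 add0r expr0n/= mul0r subr0.
have -> : (h (x + eps) + h (x - eps)) / 2 - h x - eps ^+ 2 / 2 * h2 x =
   2^-1 * (h (x + eps) + h (x - eps) - eps ^+ 2 * h2 x - (h x + h x)) by field.
rewrite normrM (ger0_norm (_ : 0 <= 2^-1))//.
move: (`|_|) => u; lra.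
Qed.

End real_calculus.

(** * Integrals against the standard Gaussian density *)

Section gauss.
Context {R : realType}.
Notation mu := (@lebesgue_measure R).
Implicit Types (chi xi : R -> R).

Definition gauss chi : R := \int[mu]_z (chi z * normal_pdf 0 1 z).

(** Large enough for bounded functions, for [z ^+ 2], and for the products [z * chi z] of Gaussian
    integration by parts. *)
Definition quad_growth chi := measurable_fun [set: R] chi /\
  exists C : R, forall z, `|chi z| <= C * (1 + z ^+ 2).

Let pdf_ge0 (z : R) : 0 <= normal_pdf 0 1 z. Proof. exact: normal_pdf_ge0. Qed.

Let eq_int (f g : R -> \bar R) : f =1 g ->
  mu.-integrable [set: R] f -> mu.-integrable [set: R] g.
Proof. by move=> /funext ->. Qed.

(** Split [e^(-z^2/2) = e^(-z^2/8) e^(-3z^2/8)] and use [3 z^2 / 8 <= e^(3z^2/8)]. The dominating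
    function is a multiple of the normal density with standard deviation 2. *)
Lemma sq_pdf_le (z : R) : z ^+ 2 * normal_pdf 0 1 z <=
  (8 / 3 * (@normal_peak R 1 / normal_peak 2)) * normal_pdf 0 2 z.
Proof.
rewrite !normal_pdfE ?oner_eq0//=.
have p1 : 0 < @normal_peak R 1 by rewrite normal_peak_gt0.
have p2 : 0 < @normal_peak R 2 by rewrite normal_peak_gt0.
have -> : 8 / 3 * (@normal_peak R 1 / normal_peak 2) * (normal_peak 2 * normal_fun 0 2 z) =
  normal_peak 1 * (8 / 3 * normal_fun 0 2 z) by field; rewrite gt_eqF.
rewrite mulrCA ler_wpM2l ?(ltW p1)//.
rewrite /normal_fun !subr0.
have -> : - z ^+ 2 / (1 ^+ 2 *+ 2) = - z ^+ 2 / (2 ^+ 2 *+ 2) - 3 / 8 * z ^+ 2 :> R by field.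
rewrite expRD mulrCA [leRHS]mulrC ler_wpM2l ?expR_ge0//.
have := expR_ge1Dx (3 / 8 * z ^+ 2); rewrite expRN.
set E := expR _ => EE; have E0 : 0 < E by exact: expR_gt0.
rewrite ler_pdivrMr//; lra.
Qed.

Lemma measurable_sqr : measurable_fun [set: R] (fun z : R => z ^+ 2).
Proof. exact: exprn_measurable. Qed.

Lemma integrable_growth_pdf :
  mu.-integrable [set: R] (EFin \o (fun z => (1 + z ^+ 2) * normal_pdf 0 1 z)).
Proof.
have i1 : mu.-integrable [set: R] (EFin \o (fun z => normal_pdf 0 1 z)).
  exact: integrable_normal_pdf.
have i2 : mu.-integrable [set: R] (EFin \o (fun z => z ^+ 2 * normal_pdf 0 1 z)).
  pose c := 8 / 3 * (@normal_peak R 1 / normal_peak 2).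
  apply: (@le_integrable _ _ _ mu setT _ _ (EFin \o (fun z => c * normal_pdf 0 2 z))) => //.
  - apply/measurable_EFinP/measurable_funM; first exact: measurable_sqr.
    exact: measurable_normal_pdf.
  - move=> z _ /=; rewrite lee_fin ger0_norm; last by rewrite mulr_ge0 ?sqr_ge0 ?normal_pdf_ge0.
    by apply: le_trans (ler_norm _); exact: sq_pdf_le.
  - have i3 : mu.-integrable [set: R] (EFin \o (fun z => normal_pdf 0 2 z)).
      exact: integrable_normal_pdf.
    have := integrableZl measurableT c i3.
    by apply: eq_int => z; rewrite /= EFinM.
have := integrableD measurableT i1 i2.
by apply: eq_int => z; rewrite /= -EFinD mulrDl mul1r.
Qed.

Lemma quad_growth_integrable chi : quad_growth chi ->
  mu.-integrable [set: R] (EFin \o (fun z => chi z * normal_pdf 0 1 z)).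
Proof.
move=> [mc [C hC]].
have := integrableZl measurableT C integrable_growth_pdf.
apply: le_integrable => //.
  by apply/measurable_EFinP/measurable_funM => //; exact: measurable_normal_pdf.
move=> z _ /=; rewrite lee_fin mulrA !normrM ler_wpM2r//.
by rewrite -normrM; apply: le_trans (ler_norm _).
Qed.

Lemma quad_growth_sq : quad_growth (fun z => z ^+ 2).
Proof.
split; first exact: measurable_sqr.
by exists 1 => z; rewrite ger0_norm ?sqr_ge0// mul1r lerDr.
Qed.

Lemma quad_growth_bounded chi (C : R) : measurable_fun [set: R] chi ->
  (forall z, `|chi z| <= C) -> quad_growth chi.
Proof.
move=> mc hC; split => //; exists C => z; apply: (le_trans (hC z)).
have C0 : 0 <= C by exact: le_trans (hC 0).
by rewrite ler_peMr// lerDl sqr_ge0.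
Qed.

Lemma quad_growth_lin chi xi (a b : R) : quad_growth chi -> quad_growth xi ->
  quad_growth (fun z => a * chi z + b * xi z).
Proof.
move=> [m1 [C1 h1]] [m2 [C2 h2]]; split.
  by apply: measurable_funD; apply: measurable_funM.
exists (`|a| * C1 + `|b| * C2) => z; apply: (le_trans (ler_normD _ _)).
by rewrite !normrM mulrDl -!mulrA lerD// ler_wpM2l.
Qed.

Lemma gauss_lin chi xi (a b : R) : quad_growth chi -> quad_growth xi ->
  gauss (fun z => a * chi z + b * xi z) = a * gauss chi + b * gauss xi.
Proof.
move=> q1 q2; rewrite /gauss.
under eq_Rintegral do rewrite mulrDl -!mulrA.
rewrite RintegralD//.
- by rewrite !RintegralZl//; exact: quad_growth_integrable.
- have := integrableZl measurableT a (quad_growth_integrable q1).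
  by apply: eq_int => z; rewrite /= EFinM.
- have := integrableZl measurableT b (quad_growth_integrable q2).
  by apply: eq_int => z; rewrite /= EFinM.
Qed.

Lemma gauss_cst (a : R) : gauss (cst a) = a.
Proof.
rewrite /gauss RintegralZl//; last exact: integrable_normal_pdf.
by rewrite /Rintegral integral_normal_pdf mulr1.
Qed.

Lemma gauss_le chi xi : quad_growth chi -> quad_growth xi ->
  (forall z, chi z <= xi z) -> gauss chi <= gauss xi.
Proof.
move=> q1 q2 le12; apply: le_Rintegral => //; try exact: quad_growth_integrable.
by move=> z _; rewrite ler_wpM2r.
Qed.

(** Kept as a symbol, since it enters error constants only. *)
Definition sq_moment := gauss (fun z => z ^+ 2).

Lemma sq_moment_ge0 : 0 <= sq_moment.
Proof. by apply: Rintegral_ge0 => z _; rewrite mulr_ge0 ?sqr_ge0. Qed.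

Lemma gauss_dist_le chi xi (a b : R) : quad_growth chi -> quad_growth xi ->
  (forall z, `|chi z - xi z| <= a + b * z ^+ 2) ->
  `|gauss chi - gauss xi| <= a + b * sq_moment.
Proof.
move=> q1 q2 h.
have qc : quad_growth (cst a) by apply: (@quad_growth_bounded _ `|a|).
have q3 := quad_growth_lin 1 b qc quad_growth_sq.
have E : gauss (fun z => 1 * cst a z + b * z ^+ 2) = a + b * sq_moment.
  by rewrite (gauss_lin 1 b qc quad_growth_sq) gauss_cst mul1r.
have D : gauss (fun z => 1 * chi z + -1 * xi z) = gauss chi - gauss xi.
  by rewrite (gauss_lin 1 (-1) q1 q2) mul1r mulN1r.
have q4 := quad_growth_lin 1 (-1) q1 q2.
have q5 := quad_growth_lin (-1) 0 q3 q3.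
rewrite ler_norml -D -E; apply/andP; split; last first.
  by apply: gauss_le => // z; rewrite mulN1r !mul1r; have := h z; rewrite ler_norml => /andP[].
have -> : - gauss (fun z => 1 * cst a z + b * z ^+ 2) =
  gauss (fun z => -1 * (1 * cst a z + b * z ^+ 2) + 0 * (1 * cst a z + b * z ^+ 2)).
  by rewrite (gauss_lin (-1) 0 q3 q3) mul0r addr0 mulN1r.
apply: gauss_le => // z; rewrite mul0r addr0 !mulN1r !mul1r.
by have := h z; rewrite ler_norml => /andP[].
Qed.

Lemma is_derive_normal_pdf (z : R) :
  is_derive z 1 (normal_pdf 0 1) (- z * normal_pdf 0 1 z).
Proof.
rewrite normal_pdfE ?oner_eq0//= /normal_fun.
apply: is_derive_eq; rewrite /GRing.scale /= !subr0; by field.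
Qed.

Lemma continuous_of_derive {f df : R -> R} :
  (forall z : R, is_derive z 1 f (df z)) -> continuous f.
Proof.
move=> fdf z; apply: differentiable_continuous; apply/derivable1_diffP.
by have [] := fdf z.
Qed.

Lemma quad_growth_mulz chi (M : R) : measurable_fun [set: R] chi ->
  (forall z, `|chi z| <= M) -> quad_growth (fun z => z * chi z).
Proof.
move=> mc hM; split; first by apply: measurable_funM.
exists M => z; rewrite normrM mulrC ler_pM//.
rewrite -[z ^+ 2]real_normK ?num_real//; move: (`|z|) => u.
have := sqr_ge0 (u - 1); have := sqr_ge0 u; lra.
Qed.

(** The two integrands differ by the derivative of [chi z * normal_pdf 0 1 z], which vanishes
    outside a bounded interval. *)
Lemma gaussian_by_parts {chi dchi : R -> R} (L M : R) :
  (forall z : R, is_derive z 1 chi (dchi z)) -> continuous dchi ->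
  (forall z, `|chi z| <= M) -> (forall z, `|dchi z| <= M) ->
  (forall z, L <= `|z| -> chi z = 0 /\ dchi z = 0) ->
  gauss (fun z => z * chi z) = gauss dchi.
Proof.
move=> Dchi cdchi chiM dchiM supp.
have cchi := continuous_of_derive Dchi.
have q1 : quad_growth dchi.
  by apply: (@quad_growth_bounded _ M) => //; exact: continuous_measurable_fun.
have q2 : quad_growth (fun z => z * chi z).
  by apply: (@quad_growth_mulz _ M) => //; exact: continuous_measurable_fun.
pose f z := dchi z * normal_pdf 0 1 z - z * chi z * normal_pdf 0 1 z.
pose F z := chi z * normal_pdf 0 1 z.
pose A := `|L| + 1.
have A0 : 0 < A by rewrite ltr_wpDl.
have LA : L <= A by apply: (le_trans (ler_norm _)); rewrite lerDl.
have DF (z : R) : is_derive z 1 F (f z).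
  have H1 := Dchi z; have H2 := is_derive_normal_pdf z.
  rewrite /F; apply: is_derive_eq; rewrite /GRing.scale /= /f; ring.
have cp : continuous (@normal_pdf R 0 1) by apply: continuous_normal_pdf; rewrite oner_eq0.
have cf : continuous f.
  move=> z; apply: (@cvgB _ R^o); apply: cvgM; try exact: cp; first exact: cdchi.
  by apply: cvgM; [exact: cvg_id|exact: cchi].
have FA : F A = 0.
  by rewrite /F; have [|-> _] := supp A; rewrite ?mul0r// ger0_norm// ltW.
have FNA : F (- A) = 0.
  by rewrite /F; have [|-> _] := supp (- A); rewrite ?mul0r// normrN ger0_norm// ltW.
have cF := continuous_of_derive DF.
have FTC : (\int[mu]_(x in `[(- A)%R, A]) (f x)%:E = 0)%E.
  rewrite (@continuous_FTC2 _ f F) ?FA ?FNA ?sube0//.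
  - by rewrite gtrN.
  - exact: continuous_subspaceT.
  - split.
    + by move=> x _; have [] := DF x.
    + by apply: cvg_at_right_filter; exact: cF.
    + by apply: cvg_at_left_filter; exact: cF.
  - by move=> x _; rewrite derive1E; have [_ ->] := DF x.
apply/eqP; rewrite eq_sym -subr_eq0; apply/eqP.
rewrite /gauss -RintegralB//; try exact: quad_growth_integrable.
rewrite -[RHS]/(fine 0%E) -FTC -/(Rintegral _ _ _) [RHS]Rintegral_mkcond.
apply: eq_Rintegral => z _; rewrite patchE; case: ifPn => // zn.
have [|-> ->] := supp z; last by rewrite !(mul0r, mulr0) subr0.
apply: (le_trans LA); rewrite leNgt; apply/negP => zA; move/negP: zn; apply.
by rewrite inE/= in_itv/= -ler_norml ltW.
Qed.

End gauss.

(** * Gaussian averages against iterated two-point averages *)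

Section clt.
Context {R : realType}.
Implicit Types (h : R -> R).

Definition avg1 (eps : R) h (z : R) := (h (z + eps) + h (z - eps)) / 2.

(** [eta] bounds the oscillation of the second derivative at the scale [eps] of the steps. The
    bounds [M] and [eta] survive averaging unchanged, so they serve along the whole walk; the
    support radius grows with each average and is therefore existential. *)
Record smooth_bump (M eta eps : R) (h h1 h2 : R -> R) : Prop := SmoothBump {
  sb_d1 : forall z : R, is_derive z 1 h (h1 z) ;
  sb_d2 : forall z : R, is_derive z 1 h1 (h2 z) ;
  sb_cont : continuous h2 ;
  sb_bound : forall z, [/\ `|h z| <= M, `|h1 z| <= M & `|h2 z| <= M] ;
  sb_osc : forall z t, `|t| <= eps -> `|h2 (z + t) - h2 z| <= eta ;
  sb_supp : exists L, forall z, L <= `|z| -> [/\ h z = 0, h1 z = 0 & h2 z = 0] }.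

Lemma is_derive_avg1 (eps : R) {h h1 : R -> R} :
  (forall z : R, is_derive z 1 h (h1 z)) ->
  forall z : R, is_derive z 1 (avg1 eps h) (avg1 eps h1 z).
Proof.
move=> D z; have H1 := is_derive_affine 1 eps z D; have H2 := is_derive_affine 1 (- eps) z D.
have -> : avg1 eps h = (fun t => (h (1 * t + eps) + h (1 * t - eps)) * 2^-1).
  by apply/funext => t; rewrite /avg1 !mul1r.
apply: is_derive_eq; rewrite /GRing.scale /= /avg1 !mul1r; ring.
Qed.

Lemma norm_avg1_le (eps : R) h (M z : R) : (forall y, `|h y| <= M) ->
  `|avg1 eps h z| <= M.
Proof.
move=> H; rewrite /avg1 normrM (ger0_norm (_ : 0 <= 2^-1))//.
have := ler_normD (h (z + eps)) (h (z - eps)).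
have := H (z + eps); have := H (z - eps); lra.
Qed.

Lemma smooth_bump_avg1 (M eta eps : R) h h1 h2 : 0 <= eps ->
  smooth_bump M eta eps h h1 h2 ->
  smooth_bump M eta eps (avg1 eps h) (avg1 eps h1) (avg1 eps h2).
Proof.
move=> e0 [D1 D2 C B O [L S]]; split.
- exact: is_derive_avg1.
- exact: is_derive_avg1.
- move=> z; apply: cvgM; last exact: cvg_cst.
  have shc (a : R) : h2 (y + a) @[y --> z] --> h2 (z + a).
    apply: (cvg_comp (fun y => y + a) h2); [|exact: C].
    by apply: (@cvgD _ R^o); [exact: cvg_id|exact: cvg_cst].
  by apply: (@cvgD _ R^o); exact: shc.
- by move=> z; split; apply: norm_avg1_le => y; have [] := B y.
- move=> z t te.
  have -> : avg1 eps h2 (z + t) - avg1 eps h2 z = avg1 eps (fun y => h2 (y + t) - h2 y) z.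
    by rewrite /avg1 [z + t + eps]addrAC [z + t - eps]addrAC; lra.
  by apply: norm_avg1_le => y; exact: O.
- exists (L + eps) => z Lz.
  have [a1 a2 a3] : [/\ h (z + eps) = 0, h1 (z + eps) = 0 & h2 (z + eps) = 0].
    apply: S; have := ler_normB (z + eps) eps; rewrite addrK (ger0_norm e0); lra.
  have [b1 b2 b3] : [/\ h (z - eps) = 0, h1 (z - eps) = 0 & h2 (z - eps) = 0].
    apply: S; have := ler_normD (z - eps) eps; rewrite subrK (ger0_norm e0); lra.
  by rewrite /avg1 a1 a2 a3 b1 b2 b3 addr0 mul0r.
Qed.

Lemma quad_growth_scaled (s : R) h (M : R) : continuous h -> (forall z, `|h z| <= M) ->
  quad_growth (fun z => h (s * z)).
Proof.
move=> ch hM; apply: (@quad_growth_bounded _ _ M) => //.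
apply: measurableT_comp; first exact: continuous_measurable_fun.
exact: mulrl_measurable.
Qed.

(** An average adds the variance [eps^2], and so does the passage from [s] to [s + c]. To first
    order in [c] the latter contributes [c E[Z h1(s Z)]], which is [c s E[h2(s Z)]] by integration
    by parts, and [c s = eps^2 / 2 - c^2 / 2]. The second difference contributes [eps^2 / 2] times
    the same expectation. *)
Lemma gauss_scaled_avg1 (M eta eps s c : R) h h1 h2 : 0 <= eps -> 0 < s ->
  (s + c) ^+ 2 - s ^+ 2 = eps ^+ 2 -> smooth_bump M eta eps h h1 h2 ->
  `|gauss (fun z => h ((s + c) * z)) - gauss (fun z => avg1 eps h (s * z))| <=
  M * (1 + sq_moment) * c ^+ 2 + eps ^+ 2 * eta.
Proof.
move=> e0 s0 sc H; have [D1 D2 C B O [L S]] := H.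
have M0 : 0 <= M by have [/(le_trans (normr_ge0 _))] := B 0.
have c0 := continuous_of_derive D1; have c1 := continuous_of_derive D2.
have B0 z : `|h z| <= M by have [] := B z.
have B1 z : `|h1 z| <= M by have [] := B z.
have B2 z : `|h2 z| <= M by have [] := B z.
have q0 := quad_growth_scaled s c0 B0.
have q1 : quad_growth (fun z => z * h1 (s * z)).
  apply: (@quad_growth_mulz _ _ M) => //.
  by have [] := quad_growth_scaled s c1 B1.
have q2 := quad_growth_scaled s C B2.
have qsc := quad_growth_scaled (s + c) c0 B0.
have qa : quad_growth (fun z => avg1 eps h (s * z)).
  apply: (@quad_growth_scaled _ _ M); last by move=> z; exact: norm_avg1_le.
  exact: continuous_of_derive (is_derive_avg1 eps D1).
have stein : gauss (fun z => z * h1 (s * z)) = s * gauss (fun z => h2 (s * z)).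
  have -> : s * gauss (fun z => h2 (s * z)) = gauss (fun z => s * h2 (s * z)).
    by rewrite -[LHS]addr0 -(mul0r (gauss (fun z => h2 (s * z)))) -gauss_lin//;
       congr gauss; apply/funext => z; rewrite mul0r addr0.
  apply: (@gaussian_by_parts _ _ _ (L / s) (M + s * M)).
  - move=> z; have := is_derive_affine s 0 z D2.
    by under eq_fun do rewrite addr0; rewrite addr0.
  - move=> z; apply: cvgM; first exact: cvg_cst.
    apply: (cvg_comp (fun y => s * y) h2); last exact: C.
    by apply: cvgM; [exact: cvg_cst|exact: cvg_id].
  - by move=> z; apply: (le_trans (B1 _)); rewrite lerDl mulr_ge0// ltW.
  - move=> z; rewrite normrM (gtr0_norm s0).
    by apply: (@le_trans _ _ (s * M)); rewrite ?ler_wpM2l ?lerDr// ltW.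
  - move=> z Lz; have [|_ -> ->] := S (s * z); last by rewrite mulr0.
    by rewrite normrM (gtr0_norm s0) mulrC -ler_pdivrMr.
pose T1 z := 1 * h (s * z) + c * (z * h1 (s * z)).
pose T2 z := 1 * h (s * z) + (eps ^+ 2 / 2) * h2 (s * z).
have t1 : `|gauss (fun z => h ((s + c) * z)) - gauss T1| <= 0 + (M * c ^+ 2) * sq_moment.
  apply: gauss_dist_le => //; first exact: quad_growth_lin.
  move=> z; rewrite add0r /T1 mul1r.
  have := taylor_order2 (s * z) (c * z) D1 D2 B2.
  by rewrite -mulrDl exprMn mulrA opprD addrA -mulrA => /le_trans; apply; rewrite mulrA.
have t2 : `|gauss (fun z => avg1 eps h (s * z)) - gauss T2| <= eps ^+ 2 * eta + 0 * sq_moment.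
  apply: gauss_dist_le => //; first exact: quad_growth_lin.
  move=> z; rewrite mul0r addr0 /T2 mul1r opprD addrA.
  exact: (second_difference e0 D1 D2 (O (s * z))).
have g2 : `|gauss (fun z => h2 (s * z))| <= M.
  have := @gauss_dist_le _ (fun z => h2 (s * z)) (cst 0) M 0 q2.
  rewrite gauss_cst subr0 mul0r addr0; apply.
    by apply: (@quad_growth_bounded _ _ 0) => // z; rewrite normr0.
  by move=> z; rewrite subr0 mul0r addr0.
move: t1 t2; rewrite /T1 /T2 !gauss_lin// stein mul1r mul0r add0r addr0.
set G2 := gauss (fun z => h2 _) in g2 *; set G0 := gauss (fun z => h ((s + c) * z)).
set Gs := gauss (fun z => h (s * z)); set Ga := gauss _.
move=> t1 t2.
have E : c * (s * G2) = (eps ^+ 2 / 2) * G2 - c ^+ 2 / 2 * G2.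
  by rewrite -sc; field.
have cG : `|c ^+ 2 / 2 * G2| <= c ^+ 2 / 2 * M.
  have c20 : 0 <= c ^+ 2 / 2 by rewrite divr_ge0 ?sqr_ge0.
  by rewrite normrM (ger0_norm c20) ler_wpM2l.
have cM : 0 <= c ^+ 2 * M by rewrite mulr_ge0 ?sqr_ge0.
move: t1 t2 cG; rewrite !ler_norml => /andP[t1 t1'] /andP[t2 t2'] /andP[g g'].
apply/andP; split; lra.
Qed.

(** The comparison above requires a positive standard deviation [s]. The step that leaves 0 is
    treated by the Lipschitz bound, at the price of an error [O(eps)] that occurs once. *)
Lemma gauss_first_step (M eta eps : R) h h1 h2 : 0 <= eps ->
  smooth_bump M eta eps h h1 h2 ->
  `|gauss (fun z => h (eps * z)) - avg1 eps h 0| <= M * (2 + sq_moment) * eps.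
Proof.
move=> e0 H; have [D1 D2 C B O S] := H.
have M0 : 0 <= M by have [/(le_trans (normr_ge0 _))] := B 0.
have B0 z : `|h z| <= M by have [] := B z.
have Lip x y : `|h y - h x| <= M * `|y - x|.
  have [c _ ->] := mean_value_any x y D1.
  by rewrite normrM ler_wpM2r//; have [] := B c.
have := @gauss_dist_le _ (fun z => h (eps * z)) (cst (avg1 eps h 0)) (2 * M * eps) (M * eps).
rewrite gauss_cst (_ : 2 * M * eps + M * eps * sq_moment = M * (2 + sq_moment) * eps); last by ring.
apply.
- exact: quad_growth_scaled (continuous_of_derive D1) B0.
- exact: (@quad_growth_bounded _ _ `|avg1 eps h 0|).
- move=> z; rewrite /avg1 add0r sub0r.
  have A1 := Lip eps (eps * z); have A2 := Lip (- eps) (eps * z).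
  have -> : h (eps * z) - (h eps + h (- eps)) / 2 =
    2^-1 * ((h (eps * z) - h eps) + (h (eps * z) - h (- eps))) by field.
  rewrite normrM (ger0_norm (_ : 0 <= 2^-1))//.
  have z1 (b : R) : `|b| = eps -> `|eps * z - b| <= eps * (2 + z ^+ 2).
    move=> bE; apply: (le_trans (ler_normB _ _)); rewrite normrM bE (ger0_norm e0).
    rewrite -{2}[eps]mulr1 -mulrDr ler_wpM2l// -[z ^+ 2]real_normK ?num_real//.
    move: (`|z|) => u; have := sqr_ge0 (u - 1); have := sqr_ge0 u; lra.
  have Z1 := z1 eps (ger0_norm e0).
  have Z2 : `|eps * z - - eps| <= eps * (2 + z ^+ 2) by apply: z1; rewrite normrN ger0_norm.
  have := ler_normD (h (eps * z) - h eps) (h (eps * z) - h (- eps)).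
  have := ler_wpM2l M0 Z1; have := ler_wpM2l M0 Z2.
  move: A1 A2; move: (`|_ - _|) (`|_ - _|) => *; lra.
Qed.

(** The induction absorbs the average nearest to [h]: one change of standard deviation turns [h]
    into [avg1 eps h], which has the same constants. *)
Lemma gauss_iter_avg1 (M eta eps : R) k h h1 h2 : 0 < eps ->
  smooth_bump M eta eps h h1 h2 ->
  `|gauss (fun z => h (eps * Num.sqrt k.+1%:R * z)) - iter k.+1 (avg1 eps) h 0| <=
  M * (2 + sq_moment) * eps + M * (1 + sq_moment) * eps ^+ 2 * Num.sqrt k.+1%:R
    + k%:R * eps ^+ 2 * eta.
Proof.
move=> ep; have e0 := ltW ep; have m0 := @sq_moment_ge0 R; elim: k h h1 h2 => [|k IH] h h1 h2 H.
  rewrite sqrtr1 mulr1 /= !mul0r addr0.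
  apply: (le_trans (gauss_first_step e0 H)); rewrite lerDl.
  have [/(le_trans (normr_ge0 _)) M0 _ _] := sb_bound H 0.
  by rewrite !mulr_ge0 ?sqr_ge0// addr_ge0.
have [/(le_trans (normr_ge0 _)) M0 _ _] := sb_bound H 0.
pose sk : R := Num.sqrt k.+1%:R; pose sk1 : R := Num.sqrt k.+2%:R.
have sk0 : 0 < sk by rewrite sqrtr_gt0.
have sk2 : sk ^+ 2 = k.+1%:R by rewrite sqr_sqrtr.
have sk12 : sk1 ^+ 2 = k.+2%:R by rewrite sqr_sqrtr.
have sk1sk : sk <= sk1 by rewrite ler_wsqrtr// ler_nat.
have sqd : sk1 ^+ 2 - sk ^+ 2 = 1 by rewrite sk2 sk12 -[k.+2%:R]natr1; ring.
pose c := eps * (sk1 - sk).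
have s0 : 0 < eps * sk by rewrite mulr_gt0.
have := @gauss_scaled_avg1 M eta eps (eps * sk) c h h1 h2 e0 s0.
have -> : eps * sk + c = eps * sk1 by rewrite /c; ring.
have -> : (eps * sk1) ^+ 2 - (eps * sk) ^+ 2 = eps ^+ 2 by rewrite !exprMn -mulrBr sqd mulr1.
move=> /(_ erefl H) step.
have := IH _ _ _ (smooth_bump_avg1 e0 H); rewrite -iterSr -/sk => ih.
have d1 : sk1 - sk <= 1.
  have : 1 <= sk by rewrite -[leLHS]sqrtr1 ler_wsqrtr// ler1n.
  nra.
(* The errors [c ^+ 2] of the successive steps are dominated by a telescoping sum. *)
have c2 : c ^+ 2 <= eps ^+ 2 * (sk1 - sk).
  rewrite /c exprMn ler_wpM2l ?sqr_ge0// expr2 ler_piMr//; lra.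
have := ler_distD (gauss (fun z => avg1 eps h (eps * sk * z)))
  (gauss (fun z => h (eps * sk1 * z))) (iter k.+2 (avg1 eps) h 0).
have Mm : 0 <= M * (1 + sq_moment) by rewrite mulr_ge0// addr_ge0.
have := ler_wpM2l Mm c2.
rewrite -/sk1 -[k.+1%:R]natr1.
move: step ih; move: (`|_|) (`|_|) (`|_|) => a1 a2 a3; lra.
Qed.

Lemma gauss_clt (M eta eps : R) m h h1 h2 : (0 < m)%N -> 0 <= eps ->
  eps ^+ 2 * m%:R = 1 -> smooth_bump M eta eps h h1 h2 ->
  `|gauss h - iter m (avg1 eps) h 0| <= M * (3 + 2 * sq_moment) * eps + eta.
Proof.
case: m => // k _ e0 em H.
have ep : 0 < eps.
  rewrite lt_def e0 andbT; apply/eqP => eE; move: em; rewrite eE expr0n mul0r.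
  by move=> /eqP; rewrite eq_sym oner_eq0.
have := gauss_iter_avg1 k ep H.
have es : eps * Num.sqrt k.+1%:R = 1.
  by rewrite -(ger0_norm e0) -sqrtr_sqr -sqrtrM ?sqr_ge0// em sqrtr1.
under eq_fun do rewrite es mul1r.
move=> /le_trans; apply.
have eta0 : 0 <= eta by have := sb_osc H 0 (t := 0); rewrite normr0 addr0 subrr normr0; apply.
have : k%:R * eps ^+ 2 * eta <= eta.
  by rewrite ler_piMl// -[leRHS]em mulrC ler_wpM2l ?sqr_ge0// ler_nat.
have -> : M * (1 + sq_moment) * eps ^+ 2 * Num.sqrt k.+1%:R = M * (1 + sq_moment) * eps.
  by rewrite expr2 mulrA -mulrA es mulr1.
lra.
Qed.

End clt.

(** * Discretization of Gaussian vectors *)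

Section grid.
Context {R : realType}.
Variable k : nat.

Definition grid_size := (2 * k ^ 2).+1.

Definition grid_pt (j : 'I_grid_size) : R := j%:R / k%:R - k%:R.

(* [inord] sends the overflow [z > k] to index [0], i.e. to the point [- k]. *)
Definition grid_idx (z : R) : 'I_grid_size := inord (Num.truncn (k%:R * (z + k%:R))).

(** Which end of the grid a far value reaches does not matter: a function supported in the ball of
    radius [k] vanishes before and after rounding. *)
Lemma grid_ptP (z : R) : (0 < k)%N ->
  `|z| <= k%:R /\ `|grid_pt (grid_idx z) - z| <= k%:R^-1 \/
  k%:R < `|z| /\ `|grid_pt (grid_idx z)| = k%:R.
Proof.
move=> k0; have kp : 0 < k%:R :> R by rewrite ltr0n.
rewrite /grid_pt /grid_idx; set y := k%:R * (z + k%:R).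
have [zk|kz] := lerP `|z| k%:R; [left; split => //|right; split => //].
  move: zk; rewrite ler_norml => /andP[z1 z2].
  have y0 : 0 <= y by rewrite mulr_ge0 ?(ltW kp)//; lra.
  have /andP[t1 t2] := truncn_itv y0.
  rewrite inordK; last first.
    rewrite /grid_size ltnS -(ler_nat R); apply: (le_trans t1).
    rewrite natrM natrX /y expr2 mulrCA ler_wpM2l ?(ltW kp)//; lra.
  set t := (Num.truncn y)%:R in t1 t2 *.
  have zE : z = y / k%:R - k%:R by rewrite /y mulrAC mulfV ?gt_eqF// mul1r addrK.
  rewrite zE (_ : t / _ - _ - _ = (t - y) / k%:R); last by ring.
  rewrite normrM [`|k%:R^-1|]gtr0_norm ?invr_gt0//.
  rewrite ler_piMl ?invr_ge0 ?(ltW kp)// distrC ger0_norm ?subr_ge0//.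
  by rewrite lerBlDl natr1 ltW.
have [z0|z0] := lerP 0 z.
  rewrite (ger0_norm z0) in kz.
  have y0 : 0 <= y by rewrite mulr_ge0 ?(ltW kp)//; lra.
  have ty : (2 * k ^ 2 <= Num.truncn y)%N.
    rewrite truncn_ge_nat// natrM natrX /y expr2 mulrCA ler_wpM2l ?(ltW kp)//; lra.
  (* Slightly above [k] the truncation is still [2 * k ^ 2], the last index; only beyond does
     [inord] overflow to 0. *)
  move: ty; rewrite leq_eqVlt => /orP[/eqP tE|tlt].
    rewrite inordK -tE// natrM natrX expr2 mulrA mulfK ?gt_eqF//.
    by rewrite (_ : 2 * k%:R - k%:R = k%:R) ?gtr0_norm//; ring.
  have -> : nat_of_ord (inord (Num.truncn y) : 'I_grid_size) = 0%N.
    by rewrite /inord/= val_insubd ltnS leqNgt tlt.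
  by rewrite mul0r sub0r normrN gtr0_norm.
have -> : Num.truncn y = 0%N.
  apply/eqP; rewrite -leqn0 truncn_le_nat.
  apply: (@le_lt_trans _ _ 0) => //; rewrite pmulr_rle0//.
  by move: kz; rewrite ltr0_norm//; lra.
by rewrite inordK// mul0r sub0r normrN gtr0_norm.
Qed.

Lemma measurable_grid_idx (j : 'I_grid_size) : measurable [set z : R | grid_idx z = j].
Proof.
have -> : [set z : R | grid_idx z = j] =
  \bigcup_(t in [set t : nat | inord t = j]) [set z : R | Num.truncn (k%:R * (z + k%:R)) = t].
  apply/seteqP; split=> [z zj|z [t /= tj zt]]; last by rewrite /= /grid_idx zt.
  by exists (Num.truncn (k%:R * (z + k%:R))).
apply: bigcup_measurable => t _; apply: is_interval_measurable.
move=> x y /= xt yt z /andP[xz zy]; apply/eqP; rewrite eqn_leq.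
by apply/andP; split; [rewrite -yt|rewrite -xt]; rewrite le_truncn// ler_wpM2l// lerD2r.
Qed.

End grid.

Lemma measurable_finite_range (d d' : measure_display) (T : measurableType d)
    (T' : measurableType d') (I : finType) (c : T -> I) (a : I -> T') :
  (forall i, measurable [set w | c w = i]) ->
  measurable_fun [set: T] (fun w => a (c w)).
Proof.
move=> mc _ B mB; rewrite setTI.
have -> : (fun w => a (c w)) @^-1` B =
   \bigcup_(i in [set i | B (a i)]) [set w | c w = i].
  apply/seteqP; split=> [w /= Bw|w [i /= Bi wi]]; first by exists (c w).
  by rewrite wi.
by apply: fin_bigcup_measurable; first exact: finite_finset.
Qed.

Lemma Rintegral_finite_range {R : realType} (d : measure_display)
    (T : measurableType d) (mu : {finite_measure set T -> \bar R})
    (I : finType) (c : T -> I) (a : I -> R) :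
  (forall i, measurable [set w | c w = i]) ->
  \int[mu]_w a (c w) = \sum_i a i * fine (mu [set w | c w = i]).
Proof.
move=> mc.
have E w : a (c w) = \sum_i a i * \1_[set w | c w = i] w.
  rewrite (bigD1 (c w))//= indicE mem_set// mulr1 big1 ?addr0// => i ic.
  by rewrite indicE memNset ?mulr0//= => cw; rewrite -cw eqxx in ic.
have fin i : mu [set w | c w = i] \is a fin_num by exact: fin_num_measure.
have int i : mu.-integrable setT (fun w => (a i * \1_[set w | c w = i] w)%:E).
  under eq_fun do rewrite EFinM.
  by apply: integrableZl => //; exact: integrable_indic.
rewrite /Rintegral; under eq_integral do rewrite E -sumEFin.
rewrite integral_sum//= (eq_bigr (fun i => (a i * fine (mu [set w | c w = i]))%:E)).
  by rewrite sumEFin.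
move=> i _; under eq_integral do rewrite EFinM.
rewrite integralZl//; last exact: integrable_indic.
by rewrite integral_indic// setIT EFinM fineK.
Qed.

Lemma gauss_finite_range {R : realType} (I : finType) (c : R -> I) (a : I -> R) :
  (forall i, measurable [set z | c z = i]) ->
  gauss (fun z => a (c z)) = \sum_i a i * fine (normal_prob 0 1 [set z | c z = i]).
Proof.
move=> mc; have mi i : measurable_fun setT (\1_[set z | c z = i] : R -> R).
  exact: measurable_indic.
have E z : a (c z) * normal_pdf 0 1 z =
    \sum_i a i * (\1_[set z | c z = i] z * normal_pdf 0 1 z).
  under [RHS]eq_bigr do rewrite mulrA; rewrite -mulr_suml; congr (_ * _).
  rewrite (bigD1 (c z))//= indicE mem_set// mulr1 big1 ?addr0// => i ic.
  by rewrite indicE memNset ?mulr0//= => cz; rewrite -cz eqxx in ic.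
have q i : quad_growth (\1_[set z | c z = i] : R -> R).
  apply: (@quad_growth_bounded _ _ 1) => // z.
  by rewrite indicE; case: (_ \in _); rewrite ?normr1 ?normr0.
rewrite /gauss /Rintegral; under eq_integral do rewrite E -sumEFin.
rewrite integral_sum//=; last first.
  move=> i; under eq_fun do rewrite EFinM.
  by apply: integrableZl => //; exact: quad_growth_integrable.
rewrite (eq_bigr (fun i => (a i * fine (normal_prob 0 1 [set z | c z = i]))%:E)).
  by rewrite sumEFin.
move=> i _; under eq_integral do rewrite EFinM.
rewrite integralZl//; last exact: quad_growth_integrable.
rewrite EFinM fineK; last first.
  by apply: (fin_num_measure (normal_prob 0 1)); exact: mc.
congr (_ * _)%E; rewrite /normal_prob [RHS]integral_mkcond.
apply: eq_integral => z _; rewrite patchE indicE.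
by case: (_ \in _); rewrite ?mul1r ?mul0r.
Qed.

(** * Resampling one coordinate under a product weight *)

Section finite_product.
Context {R : comNzRingType} (I J : finType) (pi : J -> R).
Hypothesis pi1 : \sum_j pi j = 1.

Definition weight (c : {ffun I -> J}) := \prod_i pi (c i).

Definition update (c : {ffun I -> J}) (i : I) (j : J) : {ffun I -> J} :=
  [ffun l => if l == i then j else c l].

(* The involution [(c, j) |-> (update c i j, c i)] preserves [weight c * pi j]. *)
Lemma sum_resample (i : I) (phi : {ffun I -> J} -> R) :
  \sum_c weight c * phi c = \sum_c weight c * \sum_j pi j * phi (update c i j).
Proof.
under [RHS]eq_bigr do rewrite mulr_sumr; rewrite pair_big/=.
pose tau (x : {ffun I -> J} * J) := (update x.1 i x.2, x.1 i).
have tauK : cancel tau tau.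
  move=> [c j]; rewrite /tau /update/= ffunE eqxx; congr pair.
  by apply/ffunP => l; rewrite !ffunE; case: eqP => // ->.
rewrite (reindex tau); last by exists tau => x _; exact: tauK.
rewrite -(pair_big xpredT xpredT (fun c j => weight (tau (c, j)).1 *
  (pi (tau (c, j)).2 * phi (update (tau (c, j)).1 i (tau (c, j)).2))))/=.
apply: eq_bigr => c _.
have E j : weight (update c i j) * (pi (c i) * phi (update (update c i j) i (c i))) =
    pi j * (weight c * phi c).
  have -> : update (update c i j) i (c i) = c.
    by apply/ffunP => l; rewrite !ffunE; case: eqP => // ->.
  rewrite /weight (bigD1 i)//= [in RHS](bigD1 i)//= ffunE eqxx.
  rewrite (eq_bigr (fun l => pi (c l))) => [|l li]; last by rewrite ffunE (negbTE li).
  ring.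
by under eq_bigr do rewrite E; rewrite -mulr_suml pi1 mul1r.
Qed.

End finite_product.

(** * Truncating and rounding vectors *)

Section coordinates.
Context {R : realType} {n : nat}.
Implicit Types x y : 'rV[R]_n.

Lemma coord_le_norm x l : `|x ord0 l| <= `|x|.
Proof.
rewrite [leRHS]/Num.norm /= mx_normrE.
exact: (le_bigmax _ (fun ij : 'I_1 * 'I_n => `|x ij.1 ij.2|) (ord0, l)).
Qed.

Lemma norm_le_coord x (a : R) : 0 <= a -> (forall l, `|x ord0 l| <= a) -> `|x| <= a.
Proof.
move=> a0 xa; rewrite [leLHS]/Num.norm /= mx_normrE; apply: bigmax_le => //.
by move=> [i l] _ /=; rewrite ord1.
Qed.

Lemma norm_unit_vec_le (e : R) l : `|e *: unit_vec l : 'rV[R]_n| <= `|e|.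
Proof.
apply: norm_le_coord => // j; rewrite /unit_vec !mxE eqxx/= normrM.
by case: (_ == _); rewrite ?normr1 ?normr0 ?mulr1 ?mulr0.
Qed.

(** Padding by 0 keeps every stage of the induction over coordinates in one space, and 0 is the
    starting point of the walk. *)
Definition trunc_vec (i : nat) x : 'rV[R]_n :=
  \row_l (if (l < i)%N then x ord0 l else 0).

Lemma trunc_vec0 x : trunc_vec 0 x = 0.
Proof. by apply/rowP => l; rewrite !mxE ltn0. Qed.

Lemma trunc_vec_full x : trunc_vec n x = x.
Proof. by apply/rowP => l; rewrite !mxE ltn_ord. Qed.

Lemma trunc_vecS x (i : 'I_n) :
  trunc_vec i.+1 x = trunc_vec i x + x ord0 i *: unit_vec i.
Proof.
apply/rowP => l; rewrite /unit_vec !mxE eqxx/= ltnS leq_eqVlt -(inj_eq val_inj).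
by case: eqP => [/val_inj ->|]; rewrite ?ltnn/= ?mulr1 ?mulr0 ?addr0 ?add0r.
Qed.

Definition grid_vec k (c : {ffun 'I_n -> 'I_(grid_size k)}) : 'rV[R]_n :=
  \row_l grid_pt (c l).

Definition cell k x : {ffun 'I_n -> 'I_(grid_size k)} :=
  [ffun l => grid_idx k (x ord0 l)].

Definition round_vec k x := grid_vec (cell k x).

Lemma round_vecE k x l : round_vec k x ord0 l = grid_pt (grid_idx k (x ord0 l)).
Proof. by rewrite mxE ffunE. Qed.

(** One relation covers full rounding, rounding of all coordinates but the one being integrated, and
    rounding of that one alone. *)
Definition partly_rounded k x y :=
  forall l, y ord0 l = x ord0 l \/ y ord0 l = grid_pt (grid_idx k (x ord0 l)).

Record unif_bump (M : R) (phi : 'rV[R]_n -> R) : Prop := UnifBump {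
  ub_unif : forall theta, 0 < theta -> exists2 delta, 0 < delta &
    forall x y, `|y - x| <= delta -> `|phi y - phi x| <= theta ;
  ub_supp : exists L : R, forall x, L <= `|x| -> phi x = 0 ;
  ub_bound : forall x, `|phi x| <= M }.

(** If some coordinate exceeds [k], both points lie outside the support. Otherwise every coordinate
    moves by at most [1 / k] and uniform continuity applies. *)
Lemma unif_bump_rounding M phi : unif_bump M phi -> forall theta : R, 0 < theta ->
  exists k, forall x y, partly_rounded k x y -> `|phi y - phi x| <= theta.
Proof.
move=> [U [L S] _] theta t0; have [delta d0 dU] := U _ t0.
pose k := (Num.truncn (Num.max L delta^-1)).+1.
have kM : Num.max L delta^-1 < k%:R by rewrite truncnS_gt.
have kL : L <= k%:R by apply: le_trans (ltW kM); rewrite le_max lexx.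
have kd : delta^-1 <= k%:R by apply: le_trans (ltW kM); rewrite le_max lexx orbT.
have kd' : k%:R^-1 <= delta by rewrite -[leRHS]invrK lef_pV2 ?posrE ?invr_gt0 ?ltr0n.
exists k => x y xy.
have [/existsP[l kl]|/existsPn small] := boolP [exists l, k%:R < `|x ord0 l|].
  have Sx : L <= `|x|.
    by apply: (le_trans kL); apply: le_trans (coord_le_norm _ l); exact: ltW.
  have Sy : L <= `|y|.
    apply: (le_trans kL); apply: le_trans (coord_le_norm _ l).
    have [->|->] := xy l; first exact: ltW.
    have [[xl _]|[_ ->]] := @grid_ptP R k (x ord0 l) isT; last by [].
    by rewrite leNgt kl in xl.
  by rewrite (S x Sx) (S y Sy) subrr normr0 ltW.
apply: dU; apply: (le_trans _ kd'); apply: norm_le_coord => // l.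
rewrite !mxE; have [->|->] := xy l; first by rewrite subrr normr0.
have [[_ //]|[xl _]] := @grid_ptP R k (x ord0 l) isT.
by have := small l; rewrite xl.
Qed.

Lemma rounded_partly k x : partly_rounded k x (round_vec k x).
Proof. by move=> l; right; rewrite round_vecE. Qed.

End coordinates.

Lemma Rintegral_cst1 {R : realType} (d : measure_display) (T : measurableType d)
    (P : probability T R) (a : R) : \int[P]_w a = a.
Proof.
rewrite Rintegral_cst// -[RHS]mulr1; congr (_ * _).
exact: (congr1 fine (probability_setT P)).
Qed.

Lemma dist_Rintegral_le {R : realType} (d : measure_display) (T : measurableType d)
    (P : probability T R) (a b : T -> R) (theta : R) :
  P.-integrable setT (EFin \o a) -> P.-integrable setT (EFin \o b) ->
  (forall w, `|a w - b w| <= theta) ->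
  `|\int[P]_w a w - \int[P]_w b w| <= theta.
Proof.
move=> ia ib ab; rewrite -RintegralB//.
have iab : P.-integrable setT (EFin \o (fun w => a w - b w)).
  by have := integrableB measurableT ia ib; under eq_fun do rewrite -EFinB.
apply: (le_trans (le_normr_Rintegral measurableT iab)).
rewrite -[leRHS](Rintegral_cst1 P).
apply: le_Rintegral => //.
- exact: integrable_norm.
- exact: finite_measure_integrable_cst.
Qed.

Section gaussian_vector.
Context {R : realType} {n : nat} {d : measure_display} {T : measurableType d}.
Variables (P : probability T R) (X : T -> 'rV[R]_n).
Hypothesis hX : std_gaussian_vector P X.
Implicit Types chi : 'rV[R]_n -> R.

Definition grid_prob k (j : 'I_(grid_size k)) : R :=
  fine (normal_prob 0 1 [set z : R | grid_idx k z = j]).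

Lemma sum_grid_prob (k : nat) : \sum_(j < grid_size k) grid_prob j = 1.
Proof.
have := @gauss_finite_range R _ (grid_idx k) (fun=> 1) (@measurable_grid_idx R k).
under [in RHS]eq_bigr do rewrite mul1r.
by rewrite -/(cst 1) gauss_cst => <-.
Qed.

Lemma measurable_cell k (c : {ffun _}) : measurable [set w | cell k (X w) = c].
Proof.
have [mX _ _] := hX.
have -> : [set w | cell k (X w) = c] =
    \bigcap_(i in [set: 'I_n]) [set w | grid_idx k (X w ord0 i) = c i].
  apply/seteqP; split=> [w /= <- i _|w /= H]; first by rewrite ffunE.
  by apply/ffunP => i; rewrite ffunE; exact: H.
apply: fin_bigcap_measurable; first exact: finite_finset.
move=> i _; have := mX i measurableT _ (@measurable_grid_idx R k (c i)).
by rewrite setTI.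
Qed.

(** Independence and the marginal laws of [X] enter here and nowhere else: the cells of the grid are
    product sets. *)
Lemma Rintegral_round_vec k chi :
  \int[P]_w chi (round_vec k (X w)) =
  \sum_c weight (@grid_prob k) c * chi (grid_vec c).
Proof.
have [mX indep law] := hX.
rewrite (Rintegral_finite_range P (fun c => chi (grid_vec c)) (@measurable_cell k)).
apply: eq_bigr => c _; rewrite mulrC; congr (_ * _).
have -> : [set w | cell k (X w) = c] =
    [set w | forall i, [set z | grid_idx k z = c i] (X w ord0 i)].
  apply/seteqP; split=> [w /= <- i|w /= H]; first by rewrite ffunE.
  by apply/ffunP => i; rewrite ffunE; exact: H.
apply: (etrans (congr1 fine (indep (fun i => [set z | grid_idx k z = c i])
  (fun i => @measurable_grid_idx R k (c i))))).
rewrite (eq_bigr (fun i => (grid_prob (c i))%:E)) => [|i _].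
  by rewrite prodEFin.
rewrite (law i [set z | grid_idx k z = c i]); last exact: measurable_grid_idx.
rewrite fineK//; apply: (fin_num_measure (normal_prob 0 1)).
exact: measurable_grid_idx.
Qed.

(** Uniform approximation by functions of the grid cell. It yields measurability and integrability
    of [chi (X w)], and reduces its expectation to finite sums. *)
Definition roundable chi := forall theta : R, 0 < theta ->
  exists k, forall x, `|chi (round_vec k x) - chi x| <= theta.

Lemma measurable_round_vec k chi :
  measurable_fun [set: T] (fun w => chi (round_vec k (X w))).
Proof.
exact: (measurable_finite_range (fun c => chi (grid_vec c)) (@measurable_cell k)).
Qed.

Lemma measurable_roundable chi : roundable chi ->
  measurable_fun [set: T] (fun w => chi (X w)).
Proof.
move=> rc.
have /choice[k hk] : forall N, exists k, forall x,
    `|chi (round_vec k x) - chi x| <= N.+1%:R^-1.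
  by move=> N; apply: rc; rewrite invr_gt0.
apply: (@measurable_fun_cvg _ _ _ _ (fun N w => chi (round_vec (k N) (X w)))).
  by move=> N; exact: measurable_round_vec.
move=> w _; apply/cvgrPdist_le => e e0.
near=> N; rewrite distrC; apply: (le_trans (hk N _)).
by apply: ltW; near: N; exact: (near_infty_natSinv_lt (PosNum e0)).
Unshelve. all: by end_near.
Qed.

Lemma integrable_bounded (a : T -> R) (M : R) : measurable_fun [set: T] a ->
  (forall w, `|a w| <= M) -> P.-integrable [set: T] (EFin \o a).
Proof.
move=> ma aM; apply: (@le_integrable _ _ _ P setT _ _ (EFin \o cst M)) => //.
- exact/measurable_EFinP.
- by move=> w _; rewrite /= lee_fin; apply: le_trans (ler_norm _).
- exact: finite_measure_integrable_cst.
Qed.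

Lemma integrable_roundable chi : roundable chi ->
  P.-integrable [set: T] (EFin \o (fun w => chi (X w))).
Proof.
move=> rc; have [k hk] := rc 1 ltr01.
apply: (@integrable_bounded _ (1 + \sum_c `|chi (@grid_vec R n k c)|)).
  exact: measurable_roundable.
move=> w; have := hk (X w); rewrite distrC => hw.
rewrite -[chi (X w)](subrK (chi (round_vec k (X w)))).
apply: (le_trans (ler_normD _ _)); rewrite lerD//.
by rewrite (bigD1 (cell k (X w)))//= lerDl sumr_ge0.
Qed.

Lemma dist_Rintegral_round_vec chi k (theta : R) : roundable chi ->
  (forall x, `|chi (round_vec k x) - chi x| <= theta) ->
  `|\sum_c weight (@grid_prob k) c * chi (grid_vec c) - \int[P]_w chi (X w)| <= theta.
Proof.
move=> rc hk; rewrite -Rintegral_round_vec.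
apply: dist_Rintegral_le => //; last exact: integrable_roundable.
apply: (@integrable_bounded _ (\sum_c `|chi (@grid_vec R n k c)|)).
  exact: measurable_round_vec.
by move=> w; rewrite (bigD1 (cell k (X w)))//= lerDl sumr_ge0.
Qed.

End gaussian_vector.

(** * The central limit theorem for Gaussian vectors *)

Section bumps.
Context {R : realType} {n : nat}.
Implicit Types (phi : 'rV[R]_n -> R) (x y : 'rV[R]_n).

Definition line phi x i (z : R) := phi (x + z *: unit_vec i).

Lemma unif_bump_avg (M eps : R) i phi : unif_bump M phi -> unif_bump M (avg eps i phi).
Proof.
move=> [U [L S] B]; split.
- move=> theta t0; have [delta d0 dU] := U _ t0; exists delta => // x y xy.
  have -> : avg eps i phi y - avg eps i phi x =
    avg eps i (fun v => phi (v + (y - x)) - phi v) x.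
    rewrite /avg; rewrite (_ : x + _ + (y - x) = y + eps *: unit_vec i); last first.
      by rewrite addrC addrA subrK.
    rewrite (_ : x - _ + (y - x) = y - eps *: unit_vec i); last first.
      by rewrite addrC addrA subrK.
    by field.
  by apply: norm_avg_le => v; apply: dU; rewrite addrAC subrr add0r.
- exists (L + `|eps|) => x Lx; rewrite /avg !S ?addr0 ?mul0r//.
    have := ler_normD (x - eps *: unit_vec i) (eps *: unit_vec i).
    rewrite subrK; have := norm_unit_vec_le eps i; lra.
  have := ler_normB (x + eps *: unit_vec i) (eps *: unit_vec i).
  rewrite addrK; have := norm_unit_vec_le eps i; lra.
- by move=> x; exact: norm_avg_le.
Qed.

Lemma smooth_bump_mean (M eta eps : R) (h h1 h2 k k1 k2 : R -> R) :
  smooth_bump M eta eps h h1 h2 -> smooth_bump M eta eps k k1 k2 ->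
  smooth_bump M eta eps (fun z => (h z + k z) / 2) (fun z => (h1 z + k1 z) / 2)
    (fun z => (h2 z + k2 z) / 2).
Proof.
move=> [D1 D2 C B O [L S]] [D1' D2' C' B' O' [L' S']].
have dmean (f f' g g' : R -> R) (z : R) : is_derive z 1 f (f' z) -> is_derive z 1 g (g' z) ->
    is_derive z 1 (fun z => (f z + g z) / 2) ((f' z + g' z) / 2).
  by move=> *; apply: is_derive_eq; rewrite /GRing.scale /=; field.
have bmean (a b r : R) : `|a| <= r -> `|b| <= r -> `|(a + b) / 2| <= r.
  move=> ar br; rewrite normrM (ger0_norm (_ : 0 <= 2^-1))//.
  by have := ler_normD a b; lra.
split.
- by move=> z; apply: dmean.
- by move=> z; apply: dmean.
- move=> z; apply: cvgM; last exact: cvg_cst.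
  by apply: (@cvgD _ R^o); [exact: C|exact: C'].
- by move=> z; have [? ? ?] := B z; have [? ? ?] := B' z; split; apply: bmean.
- move=> z t te; have -> : (h2 (z + t) + k2 (z + t)) / 2 - (h2 z + k2 z) / 2 =
    ((h2 (z + t) - h2 z) + (k2 (z + t) - k2 z)) / 2 by field.
  by apply: bmean; [exact: O|exact: O'].
- exists (Num.max L L') => z; rewrite ge_max => /andP[/S[-> -> ->] /S'[-> -> ->]].
  by rewrite addr0 mul0r.
Qed.

Definition c2_bump (M eta eps : R) phi := unif_bump M phi /\
  forall i, exists phi1 phi2, forall x,
    smooth_bump M eta eps (line phi x i) (line phi1 x i) (line phi2 x i).

Lemma line_avg (eps : R) d phi x i z : line (avg eps d phi) x i z =
  (line phi (x + eps *: unit_vec d) i z + line phi (x - eps *: unit_vec d) i z) / 2.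
Proof. by rewrite /line /avg addrAC [x - _ + _]addrAC. Qed.

Lemma c2_bump_avg (M eta eps e : R) d phi :
  c2_bump M eta eps phi -> c2_bump M eta eps (avg e d phi).
Proof.
move=> [U H]; split; first exact: unif_bump_avg.
move=> i; have [phi1 [phi2 S]] := H i.
exists (avg e d phi1), (avg e d phi2) => x.
have E u : line (avg e d u) x i = (fun z => (line u (x + e *: unit_vec d) i z +
   line u (x - e *: unit_vec d) i z) / 2) by apply/funext => z; exact: line_avg.
by rewrite !E; exact: smooth_bump_mean.
Qed.

Lemma c2_bump_walk (M eta eps e : R) ds phi :
  c2_bump M eta eps phi -> c2_bump M eta eps (walk e ds phi).
Proof. by move=> H; elim: ds => //= d ds; exact: c2_bump_avg. Qed.

Lemma walk_nseq (eps : R) m i phi x z :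
  walk eps (nseq m i) phi (x + z *: unit_vec i) = iter m (avg1 eps) (line phi x i) z.
Proof.
elim: m z => //= m IH z; rewrite /avg /avg1 -!IH.
by rewrite -!addrA -scalerDl -scalerBl.
Qed.

Lemma walk_cat (eps : R) ds ds' phi :
  walk eps (ds ++ ds') phi = walk eps ds (walk eps ds' phi).
Proof. exact: foldr_cat. Qed.

Lemma continuous_line (M : R) phi x i : unif_bump M phi -> continuous (line phi x i).
Proof.
move=> [U _ _] z; apply/cvgrPdist_le => theta t0.
have [delta d0 dU] := U _ t0; near=> y.
rewrite /line; apply: dU.
rewrite opprD addrACA subrr add0r -scalerBl.
apply: (le_trans (norm_unit_vec_le _ _)).
by near: y; apply: cvgr_dist_le => //; exact: cvg_id.
Unshelve. all: by end_near. Qed.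

Lemma line_quad_growth (M : R) phi x i : unif_bump M phi -> quad_growth (line phi x i).
Proof.
move=> U; apply: (@quad_growth_bounded _ _ M); last by move=> z; exact: (ub_bound U).
by apply: continuous_measurable_fun; exact: continuous_line U.
Qed.

(** At a vector whose coordinate [i] is 0, such as [trunc_vec i x], this puts a standard normal
    variable into that coordinate and averages. *)
Definition slice i phi x := gauss (line phi x i).

Lemma partly_rounded_trunc k x (i : nat) :
  partly_rounded k (trunc_vec i x) (trunc_vec i (round_vec k x)).
Proof.
move=> l; rewrite !mxE; case: ifP => _; last by left.
by right; rewrite ffunE.
Qed.

Lemma partly_rounded_trunc_shift k x (i : 'I_n) (z : R) :
  partly_rounded k (trunc_vec i x + z *: unit_vec i)
    (trunc_vec i (round_vec k x) + z *: unit_vec i).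
Proof.
move=> l; rewrite /unit_vec !mxE eqxx/=; case: eqP => [->|_].
  by rewrite ltnn; left.
by rewrite !mulr0 !addr0; case: ifP => _; [right; rewrite ffunE|left].
Qed.

Lemma roundable_trunc (M : R) phi i : unif_bump M phi ->
  roundable (fun x => phi (trunc_vec i x)).
Proof.
move=> U theta t0; have [k hk] := unif_bump_rounding U t0; exists k => x.
exact/hk/partly_rounded_trunc.
Qed.

Lemma slice_dist_le (M theta : R) phi i x y : unif_bump M phi ->
  (forall z, `|line phi x i z - line phi y i z| <= theta) ->
  `|slice i phi x - slice i phi y| <= theta.
Proof.
move=> U H; have := @gauss_dist_le _ _ _ theta 0 (line_quad_growth x i U) (line_quad_growth y i U).
by rewrite mul0r addr0; apply=> z; rewrite mul0r addr0.
Qed.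

Lemma roundable_slice (M : R) phi (i : 'I_n) : unif_bump M phi ->
  roundable (fun x => slice i phi (trunc_vec i x)).
Proof.
move=> U theta t0; have [k hk] := unif_bump_rounding U t0; exists k => x.
apply: (slice_dist_le U) => z.
exact/hk/partly_rounded_trunc_shift.
Qed.

End bumps.

Section gaussian_vector_clt.
Context {R : realType} {n : nat} {d : measure_display} {T : measurableType d}.
Variables (P : probability T R) (X : T -> 'rV[R]_n).
Hypothesis hX : std_gaussian_vector P X.
Implicit Types phi : 'rV[R]_n -> R.

Lemma sum_weight_grid k : \sum_(c : {ffun 'I_n -> _}) weight (@grid_prob R k) c = 1 :> R.
Proof.
have := Rintegral_round_vec hX k (cst 1); rewrite Rintegral_cst1 => ->.
by apply: eq_bigr => c _; rewrite mulr1.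
Qed.

Lemma grid_prob_ge0 k (j : 'I_(grid_size k)) : 0 <= @grid_prob R k j.
Proof. by apply: fine_ge0; apply: (measure_ge0 (normal_prob 0 1)). Qed.

(** Fubini for one coordinate of [X], up to [e / 3] three times. Both sides are close to sums over
    the grid; in the first sum [sum_resample] draws coordinate [i] afresh, and the inner sum is then
    the slice of a function rounded in that coordinate. *)
Lemma integrate_out (M : R) phi (i : 'I_n) : unif_bump M phi ->
  \int[P]_w phi (trunc_vec i.+1 (X w)) = \int[P]_w slice i phi (trunc_vec i (X w)).
Proof.
move=> U; apply/eqP; rewrite -subr_eq0 -normr_le0; apply/ler_addgt0Pr => e e0.
rewrite add0r.
have t0 : 0 < e / 3 by rewrite divr_gt0.
have [k hk] := unif_bump_rounding U t0.
have A := dist_Rintegral_round_vec hX (roundable_trunc i.+1 U)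
  (fun x => hk _ _ (partly_rounded_trunc k x i.+1)).
have B := @dist_Rintegral_round_vec _ _ _ _ _ _ hX _ k (e / 3) (roundable_slice i U)
  (fun x => slice_dist_le U (fun z => hk _ _ (partly_rounded_trunc_shift k x i z))).
have C : `|\sum_c weight (@grid_prob R k) c * phi (trunc_vec i.+1 (grid_vec c)) -
   \sum_c weight (@grid_prob R k) c * slice i phi (trunc_vec i (grid_vec c))| <= e / 3.
  rewrite (sum_resample (@sum_grid_prob R k) i) -sumrB.
  apply: (le_trans (ler_norm_sum _ _ _)).
  rewrite -[leRHS]mul1r -[X in X * _](sum_weight_grid k) mulr_suml; apply: ler_sum => c _.
  have w0 : 0 <= weight (@grid_prob R k) c by apply: prodr_ge0 => j _; exact: grid_prob_ge0.
  rewrite -mulrBr normrM (ger0_norm w0) ler_wpM2l//.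
  set x := trunc_vec i (grid_vec c).
  have E j : trunc_vec i.+1 (grid_vec (update c i j)) = x + grid_pt j *: unit_vec i.
    rewrite trunc_vecS !mxE ffunE eqxx; congr (_ + _).
    apply/rowP => l; rewrite !mxE ffunE; case: eqP => // ->.
    by rewrite ltnn.
  have -> : \sum_j @grid_prob R k j * phi (trunc_vec i.+1 (grid_vec (update c i j))) =
     gauss (fun z => line phi x i (grid_pt (grid_idx k z))).
    rewrite (gauss_finite_range (fun j => line phi x i (grid_pt j)) (@measurable_grid_idx R k)).
    by apply: eq_bigr => j _; rewrite E mulrC.
  have q : quad_growth (fun z => line phi x i (grid_pt (grid_idx k z))).
    apply: (@quad_growth_bounded _ _ M); last by move=> z; exact: (ub_bound U).
    apply: (measurable_finite_range (fun j => line phi x i (grid_pt j))).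
    exact: measurable_grid_idx.
  have := @gauss_dist_le _ _ _ (e / 3) 0 q (line_quad_growth x i U).
  rewrite mul0r addr0; apply=> z; rewrite mul0r addr0.
  apply: hk => l; rewrite /unit_vec !mxE eqxx/=; case: eqP => [->|_].
    by rewrite ltnn !mulr1 !add0r; right.
  by rewrite !mulr0; left.
move: A B C; rewrite !ler_norml => /andP[A A'] /andP[B B'] /andP[C C'].
apply/andP; split; lra.
Qed.

(** The directions are exhausted one after the other, so that each block of [m] steps is a walk on a
    line. *)
Definition sweep m i : seq 'I_n := flatten [seq nseq m l | l <- take i (enum 'I_n)].

Lemma sweepS m (i : 'I_n) : sweep m i.+1 = sweep m i ++ nseq m i.
Proof.
rewrite /sweep (take_nth i) ?size_enum_ord// map_rcons flatten_rcons.
by rewrite nth_ord_enum.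
Qed.

(** The last coordinate goes first: [integrate_out] makes it a slice, [gauss_clt] replaces the slice
    by [m] averages, and the averaged function has the same constants, so the induction continues
    with it. *)
Lemma gaussian_vector_clt (M eta eps : R) m phi i : (0 < m)%N -> 0 <= eps ->
  eps ^+ 2 * m%:R = 1 -> (i <= n)%N -> c2_bump M eta eps phi ->
  `|\int[P]_w phi (trunc_vec i (X w)) - walk eps (sweep m i) phi 0| <=
  i%:R * (M * (3 + 2 * sq_moment) * eps + eta).
Proof.
move=> m0 e0 em; elim: i phi => [|i IH] phi i_n H.
  rewrite /sweep take0/= mul0r; under eq_Rintegral do rewrite trunc_vec0.
  by rewrite Rintegral_cst1 subrr normr0.
pose o := Ordinal i_n; have [U D] := H.
rewrite (integrate_out o U) (sweepS m o) walk_cat -natr1 mulrDl mul1r.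
set err := _ + eta.
have H' := c2_bump_walk eps (nseq m o) H; have [U' _] := H'.
have S x : `|slice o phi x - walk eps (nseq m o) phi x| <= err.
  have [phi1 [phi2 sb]] := D o.
  have := gauss_clt m0 e0 em (sb x); rewrite -walk_nseq scale0r addr0.
  exact.
have step := dist_Rintegral_le (integrable_roundable hX (roundable_slice o U))
  (integrable_roundable hX (roundable_trunc i U')) (fun w => S _).
apply: (le_trans (ler_distD (\int[P]_w walk eps (nseq m o) phi (trunc_vec i (X w))) _ _)).
rewrite addrC lerD//; exact: (IH _ (ltnW i_n) H').
Qed.

End gaussian_vector_clt.

(** * Compactly supported functions *)

Lemma uniform_over_finType {R : realDomainType} (I : finType) (Q : I -> R -> Prop) :
  (forall i C C', C <= C' -> Q i C -> Q i C') -> (forall i, exists C, Q i C) ->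
  exists2 C, 0 <= C & forall i, Q i C.
Proof.
move=> mono /choice[c hc]; exists (\sum_i `|c i|); first exact: sumr_ge0.
move=> i; apply: mono (hc i); rewrite (bigD1 i)//=.
by rewrite (le_trans (ler_norm _))// lerDl sumr_ge0.
Qed.

Section compact_support.
Context {R : realType} {n : nat}.
Implicit Types (phi chi : 'rV[R]_n -> R) (x y : 'rV[R]_n).

Definition bump phi := continuous phi /\ exists L : R, forall x, L <= `|x| -> phi x = 0.

Let box (L : R) : set 'rV[R]_n := [set v | forall i, `[(- L), L]%classic (v ord0 i)].

Let box_compact L : compact (box L).
Proof.
by apply: (@rV_compact _ _ (fun=> `[(- L), L]%classic)) => _; exact: segment_compact.
Qed.

Let norm_box x L : `|x| <= L -> box L x.
Proof.
move=> xL i; rewrite /= in_itv/= -ler_norml.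
exact: le_trans (coord_le_norm x i) xL.
Qed.

Lemma bump_bounded phi : bump phi -> exists2 M, 0 <= M & forall x, `|phi x| <= M.
Proof.
move=> [C [L S]].
have [||c _ hc] := @EVT_max_rV R n (fun x => `|phi x|) (box `|L|) _ (@box_compact _).
- by exists 0; apply: norm_box; rewrite normr0.
- apply: continuous_subspaceT => x; apply: (cvg_comp phi (fun y : R => `|y|)); first exact: C.
  exact: norm_continuous.
exists `|phi c| => // x; have [xL|xL] := lerP `|x| `|L|.
  by apply: hc; rewrite inE; exact: norm_box.
by rewrite S ?normr0//; apply: le_trans (ltW xL); exact: ler_norm.
Qed.

Lemma bump_unif phi : bump phi -> forall theta : R, 0 < theta ->
  exists2 delta, 0 < delta & forall x y, `|y - x| <= delta -> `|phi y - phi x| <= theta.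
Proof.
move=> [C [L S]] theta t0.
have NC : near_covering (box (`|L| + 1)) by apply/compact_near_coveringP; exact: box_compact.
have := NC R (0 : R)^'+ (fun e x => forall y, `|y - x| <= e -> `|phi y - phi x| <= theta) _.
move=> /(_ _) [].
  move=> x _; have t2 : 0 < theta / 2 by rewrite divr_gt0.
  have /cvgrPdist_le/(_ _ t2)/nbhs_ballP[r /= r0 hr] := C x.
  have r2 : 0 < r / 2 by rewrite divr_gt0.
  exists (ball x (r / 2), [set e | e < r / 2]).
    split; first exact: nbhsx_ballx.
    exact: nbhs_right_lt.
  move=> [x' e] [/= xx' er] y yx'.
  have bx' : ball x r x' by apply: le_ball xx'; lra.
  have by' : ball x r y.
    rewrite -ball_normE/= in xx' *; rewrite distrC.
    rewrite distrC in xx'.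
    by have := ler_distD x' y x; lra.
  have H1 := hr _ bx'; have H2 := hr _ by'; rewrite distrC in H2.
  by have := ler_distD (phi x) (phi y) (phi x'); lra.
(* The cap at 1 handles [x] outside the enlarged box: then [y] is still at norm at least [L], and
   both values vanish. *)
move=> e /= e0 he; pose delta := Num.min (e / 2) 1.
have d0 : 0 < delta by rewrite lt_min divr_gt0// ltr01.
have de : delta < e by rewrite /delta gt_min; apply/orP; left; lra.
have d1 : delta <= 1 by rewrite /delta ge_min lexx orbT.
exists delta => // x y xy.
have [xL|xL] := lerP `|x| (`|L| + 1).
  apply: (he delta) => //; last exact: norm_box.
  by rewrite /= sub0r normrN gtr0_norm.
have Ll := ler_norm L.
rewrite (S x) ?(S y) ?subrr ?normr0; [exact: ltW| |lra].
have := ler_distD y x 0; rewrite !subr0 distrC; lra.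
Qed.

Lemma bump_unif_bump phi (M : R) : bump phi -> (forall x, `|phi x| <= M) -> unif_bump M phi.
Proof. by move=> B hM; split => //; [exact: bump_unif|case: B]. Qed.

Lemma bumpD phi chi : bump phi -> bump chi -> bump (fun x => phi x + chi x).
Proof.
move=> [C [L S]] [C' [L' S']]; split.
  by move=> x; exact: (cvgD (C x) (C' x)).
exists (Num.max L L') => x; rewrite ge_max => /andP[/S -> /S' ->].
by rewrite addr0.
Qed.

Lemma bumpM phi chi : continuous phi -> bump chi -> bump (fun x => phi x * chi x).
Proof.
move=> C [C' [L' S']]; split.
  by move=> x; exact: (cvgM (C x) (C' x)).
by exists L' => x /S' ->; rewrite mulr0.
Qed.

Lemma bump0 : bump (fun=> 0).
Proof. by split; [exact: cst_continuous|exists 0]. Qed.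

Lemma bump_comp (K : R -> R) phi : (forall x, {for phi x, continuous K}) -> K 0 = 0 ->
  bump phi -> bump (fun x => K (phi x)).
Proof.
move=> CK K0 [C [L S]]; split; last by exists L => x /S ->.
by move=> x; apply: (cvg_comp phi K); [exact: C|exact: CK].
Qed.

(** Pure second derivatives along the axes are all that [c2_bump] consumes, and their existence as
    bumps is stable under sums, products and composition with functions of one variable. *)
Definition bump2 phi := bump phi /\ forall i, exists phi1 phi2,
  [/\ bump phi1, bump phi2,
   forall x (z : R), is_derive z 1 (line phi x i) (line phi1 x i z) &
   forall x (z : R), is_derive z 1 (line phi1 x i) (line phi2 x i z)].

Lemma bump2D phi chi : bump2 phi -> bump2 chi -> bump2 (fun x => phi x + chi x).
Proof.
move=> [B H] [B' H']; split; first exact: bumpD.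
move=> i; have [f1 [f2 [b1 b2 D1 D2]]] := H i; have [g1 [g2 [c1 c2 E1 E2]]] := H' i.
exists (fun x => f1 x + g1 x), (fun x => f2 x + g2 x); split; [exact: bumpD|exact: bumpD| |].
  by move=> x z; apply: is_deriveD.
by move=> x z; apply: is_deriveD.
Qed.

Lemma bump2M phi chi : bump2 phi -> bump2 chi -> bump2 (fun x => phi x * chi x).
Proof.
move=> [B H] [B' H']; split; first by apply: bumpM => //; case: B.
move=> i; have [f1 [f2 [b1 b2 D1 D2]]] := H i; have [g1 [g2 [c1 c2 E1 E2]]] := H' i.
have [cB _] := B; have [cB' _] := B'; have [cb1 _] := b1; have [cc1 _] := c1.
exists (fun x => phi x * g1 x + chi x * f1 x).
exists (fun x => (phi x * g2 x + g1 x * f1 x) + (chi x * f2 x + f1 x * g1 x)); split.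
- by apply: bumpD; apply: bumpM.
- by apply: bumpD; apply: bumpD; apply: bumpM.
- by move=> x z; have := is_deriveM (D1 x z) (E1 x z).
- move=> x z; apply: is_deriveD.
    exact: (is_deriveM (D1 x z) (E2 x z)).
  exact: (is_deriveM (E1 x z) (D2 x z)).
Qed.

Lemma bump2_0 : bump2 (fun=> 0).
Proof.
split; first exact: bump0.
move=> i; exists (fun=> 0), (fun=> 0); split; try exact: bump0.
  by move=> x z; exact: is_derive_cst.
by move=> x z; exact: is_derive_cst.
Qed.

Lemma bump2_sum (I : finType) (phi : I -> 'rV[R]_n -> R) :
  (forall j, bump2 (phi j)) -> bump2 (fun x => \sum_j phi j x).
Proof.
move=> H; elim: (index_enum I) => [|j s IH].
  by under eq_fun do rewrite big_nil; exact: bump2_0.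
by under eq_fun do rewrite big_cons; exact: bump2D.
Qed.

Lemma bump2_comp (K K1 K2 : R -> R) phi : K 0 = 0 ->
  (forall x, is_derive (phi x) 1 K (K1 (phi x))) ->
  (forall x, is_derive (phi x) 1 K1 (K2 (phi x))) ->
  (forall x, {for phi x, continuous K2}) ->
  bump2 phi -> bump2 (fun x => K (phi x)).
Proof.
move=> K0 DK DK1 CK2 [B H].
have cont (f df : R -> R) : (forall x, is_derive (phi x) 1 f (df (phi x))) ->
    forall x, {for phi x, continuous f}.
  move=> D x; apply: differentiable_continuous; apply/derivable1_diffP.
  by have [] := D x.
have compc (f : R -> R) : (forall x, {for phi x, continuous f}) -> continuous (fun x => f (phi x)).
  by move=> cf x; case: B => C _; apply: (cvg_comp phi f); [exact: C|exact: cf].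
split; first by apply: bump_comp => //; exact: cont DK.
move=> i; have [f1 [f2 [b1 b2 D1 D2]]] := H i.
exists (fun x => K1 (phi x) * f1 x).
exists (fun x => K1 (phi x) * f2 x + (f1 x * K2 (phi x)) * f1 x); split.
- by apply: bumpM => //; apply: compc; exact: cont DK1.
- apply: bumpD; apply: bumpM => //; first by apply: compc; exact: cont DK1.
  have [Cf1 _] := b1; have CK := compc _ CK2.
  by move=> x; exact: (cvgM (Cf1 x) (CK x)).
- by move=> x z; have := @is_derive1_comp _ K (line phi x i) z _ _ (DK _) (D1 x z).
- move=> x z.
  have H1 := @is_derive1_comp _ K1 (line phi x i) z _ _ (DK1 _) (D1 x z).
  apply: is_derive_eq (is_deriveM H1 (D2 x z)) _; rewrite /GRing.scale/= /line; ring.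
Qed.

Lemma line_support phi x i : bump phi ->
  exists L : R, forall z : R, L <= `|z| -> line phi x i z = 0.
Proof.
move=> [_ [L S]]; exists (L + `|x|) => z Lz; apply: S.
apply: le_trans (coord_le_norm _ i).
rewrite /unit_vec !mxE !eqxx/= mulr1.
have := ler_normB (x ord0 i + z) (x ord0 i); rewrite addrAC subrr add0r.
have := coord_le_norm x i; lra.
Qed.

Lemma bump2_c2_bump phi : bump2 phi -> exists2 M, 0 <= M &
  forall eta, 0 < eta -> exists2 e0, 0 < e0 & forall eps, 0 <= eps <= e0 ->
    c2_bump M eta eps phi.
Proof.
move=> [B H].
have /choice[F hF] : forall i, exists g : ('rV[R]_n -> R) * ('rV[R]_n -> R),
  [/\ bump g.1, bump g.2,
   forall x (z : R), is_derive z 1 (line phi x i) (line g.1 x i z) &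
   forall x (z : R), is_derive z 1 (line g.1 x i) (line g.2 x i z)].
  by move=> i; have [f1 [f2 ?]] := H i; exists (f1, f2).
have [M0 M00 hM0] := bump_bounded B.
have [|i|M1 M10 hM1] := @uniform_over_finType R 'I_n
    (fun i C => forall x, `|(F i).1 x| <= C /\ `|(F i).2 x| <= C).
- by move=> i C C' CC' hC x; have [a b] := hC x; split; exact: le_trans CC'.
- have [b1 b2 _ _] := hF i.
  have [C1 C10 h1] := bump_bounded b1; have [C2 C20 h2] := bump_bounded b2.
  exists (C1 + C2) => x.
  by split; [rewrite (le_trans (h1 x))// lerDl|rewrite (le_trans (h2 x))// lerDr].
exists (M0 + M1) => [|eta eta0]; first exact: addr_ge0.
(* [C] is the inverse of a modulus of continuity, because [uniform_over_finType] requires a property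
   that persists when the constant grows. *)
have [|i|C C0 hC] := @uniform_over_finType R 'I_n
    (fun i C => 0 < C /\ forall x y, `|y - x| <= C^-1 -> `|(F i).2 y - (F i).2 x| <= eta).
- move=> i C C' CC' [C0 hC]; split; first exact: lt_le_trans CC'.
  move=> x y xy; apply: hC; apply: (le_trans xy).
  by rewrite lef_pV2// posrE// (lt_le_trans C0).
- have [_ b2 _ _] := hF i; have [delta d0 hd] := bump_unif b2 eta0.
  by exists delta^-1; rewrite invr_gt0 invrK; split.
exists (C + 1)^-1 => [|eps /andP[e0 eC]]; first by rewrite invr_gt0 ltr_wpDl.
split.
  by apply: bump_unif_bump => // x; rewrite (le_trans (hM0 x))// lerDl.
move=> i; have [b1 b2 D1 D2] := hF i; exists (F i).1, (F i).2 => x.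
have U2 : unif_bump M1 (F i).2 by apply: bump_unif_bump => // y; have [] := hM1 i y.
split.
- exact: D1.
- exact: D2.
- exact: continuous_line U2.
- move=> z; have [h1 h2] := hM1 i (x + z *: unit_vec i).
  split; [rewrite (le_trans (hM0 _))// lerDl//|rewrite (le_trans h1)// lerDr//|
          rewrite (le_trans h2)// lerDr//].
- move=> z t te; have [Cp hCi] := hC i; rewrite /line; apply: hCi.
  rewrite scalerDl addrA [x + _ + _]addrC addrK.
  apply: (le_trans (norm_unit_vec_le _ _)); apply: (le_trans te); apply: (le_trans eC).
  by rewrite lef_pV2 ?posrE ?ltr_wpDl// lerDl.
- have [L S] := line_support x i B; have [L1 S1] := line_support x i b1.
  have [L2 S2] := line_support x i b2.
  exists (Num.max L (Num.max L1 L2)) => z; rewrite !ge_max => /and3P[a b c].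
  by split; [exact: S|exact: S1|exact: S2].
Qed.

End compact_support.

Section smooth_functions.
Context {R : realType} {n : nat}.
Implicit Types (f phi : 'rV[R]_n -> R) (x y : 'rV[R]_n).

Lemma is_derive_line phi x i (z a : R) :
  is_derive (x + z *: unit_vec i) (unit_vec i) phi a -> is_derive z 1 (line phi x i) a.
Proof.
have E : (fun h : R => h^-1 *: ((line phi x i \o shift z) (h *: 1) - line phi x i z)) =
  (fun h : R => h^-1 *: ((phi \o shift (x + z *: unit_vec i)) (h *: unit_vec i)
     - phi (x + z *: unit_vec i))).
  apply/funext => h /=; congr (_ *: (_ - _)); rewrite /line; congr phi.
  by rewrite [_%:A]mulr1 scalerDl addrCA.
by move=> [D <-]; apply: DeriveDef; rewrite /derivable /derive E.
Qed.

(** The strict inequality makes the region open, so [phi] vanishes in a neighbourhood of [x]. *)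
Lemma partial_outside_support phi (L : R) i : (forall x, L < `|x| -> phi x = 0) ->
  forall x, L < `|x| -> partial i phi x = 0.
Proof.
move=> S x Lx; rewrite /partial.
have -> : 'D_(delta_mx ord0 i) phi x = 'D_(delta_mx ord0 i) (fun=> 0 : R) x.
  apply: near_eq_derive; near=> y; apply: S.
  near: y; have := @norm_continuous _ _ x; move=> /cvgr_gt; exact.
exact: derive_cst.
Unshelve. all: by end_near. Qed.

Definition partials f (s : seq 'I_n) := foldr (@partial R n) f s.

Lemma smooth_bump_partials f s : smooth f -> compactly_supported f -> bump (partials f s).
Proof.
move=> hf hc; split; first by have [] := hf s.
have [M [_ hM]] := compact_bounded hc.
have S0 x : M + 1 < `|x| -> f x = 0.
  move=> Mx; apply/eqP; apply: contraTT Mx => fx; rewrite -leNgt.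
  by apply: (hM (M + 1)); [rewrite ltrDl|exact: subset_closure].
have S : forall x, M + 1 < `|x| -> partials f s x = 0.
  by elim: s => //= i s IH; exact: partial_outside_support.
by exists (M + 2) => x Mx; apply: S; apply: lt_le_trans Mx; rewrite ltrD2l ltr1n.
Qed.

Lemma smooth_is_derive f s x i (z : R) : smooth f ->
  is_derive z 1 (line (partials f s) x i) (line (partials f (i :: s)) x i z).
Proof.
move=> hf; apply: is_derive_line; apply: derivableP.
by have [_] := hf s; apply.
Qed.

Lemma smooth_bump2 f s : smooth f -> compactly_supported f -> bump2 (partials f s).
Proof.
move=> hf hc; split; first exact: smooth_bump_partials.
move=> i; exists (partials f (i :: s)), (partials f [:: i, i & s]); split.
- exact: smooth_bump_partials.
- exact: smooth_bump_partials.
- by move=> x z; exact: smooth_is_derive.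
- by move=> x z; exact: smooth_is_derive.
Qed.

End smooth_functions.

(** * Passage to the limit *)

Section walk_limit.
Context {R : realType} {n : nat} {d : measure_display} {T : measurableType d}.
Variables (P : probability T R) (X : T -> 'rV[R]_n).
Hypothesis hX : std_gaussian_vector P X.

Lemma size_sweep m : size (sweep m n : seq 'I_n) = (n * m)%N.
Proof.
rewrite /sweep take_oversize ?size_enum_ord// size_flatten /shape -map_comp.
rewrite sumnE big_map big_enum/=.
by under eq_bigr do rewrite /= size_nseq; rewrite sum_nat_const card_ord.
Qed.

Lemma count_sweep m (j : 'I_n) : count_mem j (sweep m n) = m.
Proof.
rewrite /sweep take_oversize ?size_enum_ord// count_flatten -map_comp.
rewrite sumnE big_map big_enum/=.
under eq_bigr do rewrite /= count_nseq/=.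
by rewrite (bigD1 j)//= eqxx mul1n big1 ?addn0// => l /negbTE ->.
Qed.

Lemma bump2_clt (phi : 'rV[R]_n -> R) : bump2 phi -> forall theta : R, 0 < theta ->
  exists2 r, 0 < r & forall m eps, (0 < m)%N -> 0 <= eps <= r ->
  eps ^+ 2 * m%:R = 1 ->
  `|\int[P]_w phi (X w) - walk eps (sweep m n) phi 0| <= theta.
Proof.
move=> B theta t0; have [M M0 hM] := bump2_c2_bump B.
have n1 : 0 < n%:R + 1 :> R by rewrite ltr_wpDl.
(* Each of the [n] coordinates will cost at most [2 * eta]; [n + 1] avoids a division by 0, as
   [n = 0] is allowed here. *)
pose eta := theta / (2 * (n%:R + 1)); have eta0 : 0 < eta by rewrite divr_gt0// mulr_gt0.
have [e0 e00 he] := hM eta eta0.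
have m2 := @sq_moment_ge0 R.
pose C := M * (3 + 2 * sq_moment) + 1.
have C0 : 0 < C by rewrite /C ltr_wpDl// mulr_ge0// addr_ge0// mulr_ge0.
exists (Num.min e0 (eta / C)) => [|m eps m0 /andP[ep]].
  by rewrite lt_min e00 divr_gt0.
rewrite le_min => /andP[ee eC] em.
have c2 : c2_bump M eta eps phi by apply: he; rewrite ep ee.
have := gaussian_vector_clt hX m0 ep em (leqnn n) c2.
under eq_Rintegral do rewrite trunc_vec_full.
move=> /le_trans; apply.
have H1 : M * (3 + 2 * sq_moment) * eps <= eta.
  move: eC; rewrite ler_pdivlMr// => eC; apply: le_trans eC.
  by rewrite mulrC ler_wpM2l// /C lerDl.
apply: (@le_trans _ _ (n%:R * (eta + eta))); first by rewrite ler_wpM2l// lerD2r.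
have -> : theta = (n%:R + 1) * (eta + eta) by rewrite /eta; field; rewrite gt_eqF.
by rewrite ler_wpM2r ?lerDl// addr_ge0// ltW.
Qed.

Lemma small_steps (r : R) : 0 < r ->
  exists m eps, [/\ (0 < m)%N, 0 <= eps <= r & eps ^+ 2 * m%:R = 1].
Proof.
move=> r0; pose m := (Num.truncn (r ^- 2)).+1.
have mr : r ^- 2 < m%:R by rewrite truncnS_gt.
have m0 : 0 < m%:R :> R by rewrite ltr0n.
exists m, (Num.sqrt m%:R^-1); split => //; last first.
  by rewrite sqr_sqrtr ?invr_ge0 ?ltW// mulVf// gt_eqF.
rewrite sqrtr_ge0/= -(ger0_norm (ltW r0)) -sqrtr_sqr ler_wsqrtr//.
rewrite -[leRHS]invrK lef_pV2 ?posrE ?invr_gt0 ?exprn_gt0//; exact: ltW.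
Qed.

Lemma walkD_cst (eps : R) ds (phi : 'rV[R]_n -> R) (c : R) x :
  walk eps ds (fun y => phi y + c) x = walk eps ds phi x + c.
Proof.
elim: ds x => //= i ds IH x; rewrite /avg !IH; by field.
Qed.

End walk_limit.

Lemma continuous_ddpsi {R : realType} (r : R) : 0 <= r -> {for r, continuous (@ddpsi R)}.
Proof.
move=> r0; have B0 : 4 * (2 + r) ^+ 2 != 0.
  by rewrite mulf_neq0// expf_neq0// gt_eqF//; lra.
have H := is_derive_psi r0.
have D : derivable (@ddpsi R) r 1.
  have H2 : is_derive r 1 (fun r : R => (4 * (2 + r) ^+ 2)^-1)
      (- (4 * (2 + r) ^+ 2) ^- 2 * (8 * (2 + r))).
    have H3 : is_derive r 1 (fun r : R => 4 * (2 + r) ^+ 2) (8 * (2 + r)).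
      by apply: is_derive_eq; rewrite /GRing.scale /=; ring.
    exact: (@is_deriveV _ (fun r : R => 4 * (2 + r) ^+ 2)).
  by rewrite /ddpsi; apply: ex_derive.
by apply: differentiable_continuous; apply/derivable1_diffP.
Qed.

(** * The exponential of a test function along the walk *)

Section exponential.
Context {R : realType} {n : nat}.
Variable f : 'rV[R]_n -> R.
Hypotheses (hf : smooth f) (hc : compactly_supported f).
Implicit Types x : 'rV[R]_n.

Let f_ (j : 'I_n) := partials f [:: j].

Definition sq_grad x := \sum_j f_ j x ^+ 2.

(** Outside the support of [f] the exponential is 1; subtracting this constant gives a bump. *)
Definition exp_excess x := expR (f x) - 1.

(** The value of [bell] at the end of the walk, where [u = expR f] and all clocks are 1, minus its
    value [psi 0] off the support. *)
Definition bell_excess x := f x + (psi (sq_grad x) - psi 0).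

Let bf : bump2 f. Proof. exact: (smooth_bump2 [::]). Qed.

Lemma sq_grad_ge0 x : 0 <= sq_grad x.
Proof. by apply: sumr_ge0 => j _; exact: sqr_ge0. Qed.

Lemma bump2_exp_excess : bump2 exp_excess.
Proof.
have De (t : R) : is_derive t 1 (fun s => expR s - 1) (expR t).
  by apply: is_derive_eq; rewrite subr0.
apply: (@bump2_comp _ _ (fun t => expR t - 1) expR expR) => //.
- by rewrite expR0 subrr.
- by move=> x; exact: continuous_expR.
Qed.

Lemma bump2_sq_grad : bump2 sq_grad.
Proof.
rewrite /sq_grad; apply: bump2_sum => j.
by under eq_fun do rewrite expr2; apply: bump2M; exact: smooth_bump2.
Qed.

Lemma bump2_bell_excess : bump2 bell_excess.
Proof.
apply: bump2D => //.
apply: (@bump2_comp _ _ (fun t => psi t - psi 0) (@dpsi R) (@ddpsi R)).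
- by rewrite subrr.
- move=> x; have H := is_derive_psi (sq_grad_ge0 x).
  by apply: is_derive_eq; rewrite subr0.
- by move=> x; exact: is_derive_dpsi (sq_grad_ge0 x).
- by move=> x; exact: continuous_ddpsi (sq_grad_ge0 x).
- exact: bump2_sq_grad.
Qed.

Let u x := expR (f x).
Let p (j : 'I_n) x := expR (f x) * f_ j x.

Let bump2_p j : bump2 (p j).
Proof.
have -> : p j = (fun x => exp_excess x * f_ j x + f_ j x).
  by apply/funext => x; rewrite /p /exp_excess; ring.
apply: bump2D; last exact: smooth_bump2.
apply: bump2M; [exact: bump2_exp_excess|exact: smooth_bump2].
Qed.

Let derive_u x i (z : R) : is_derive z 1 (line u x i) (line (p i) x i z).
Proof.
have H : is_derive z 1 (line f x i) (line (f_ i) x i z) by exact: (smooth_is_derive [::]).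
exact: (@is_derive1_comp _ expR (line f x i) z _ _ (is_derive_expR _) H).
Qed.

Lemma half_diff_le (phi dphi : 'rV[R]_n -> R) (C eps : R) i x : 0 <= eps ->
  (forall z : R, is_derive z 1 (line phi x i) (line dphi x i z)) ->
  (forall y, `|dphi y| <= C) -> `|half_diff eps i phi x| <= C * eps.
Proof.
move=> e0 D hC; have [z _ E] := mean_value_any (- eps) eps D.
have -> : half_diff eps i phi x = line dphi x i z * eps.
  rewrite /half_diff -scaleNr -[phi _]/(line phi x i eps).
  by rewrite -[phi (_ + - _ *: _)]/(line phi x i (- eps)) E; field.
by rewrite normrM (ger0_norm e0) ler_wpM2r//; exact: hC.
Qed.

Lemma walk_class_exp : exists c C, [/\ 0 < c, 0 <= C &
  forall eps, 0 <= eps -> walk_class c C eps u p].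
Proof.
have [M0 _ hM0] := bump_bounded (proj1 bf).
have [|j|C C0 hC] := @uniform_over_finType R 'I_n (fun j C =>
    (forall x, `|p j x| <= C) /\ forall i, exists2 q, (forall x, `|q x| <= C) &
    forall x (z : R), is_derive z 1 (line (p j) x i) (line q x i z)).
- move=> j C C' CC' [h1 h2]; split=> [x|i]; first exact: le_trans CC'.
  by have [q hq Dq] := h2 i; exists q => // x; exact: le_trans CC'.
- have [M _ /(_ 1 ltr01)[e0 e00 /(_ e0)[|U H]]] := bump2_c2_bump (bump2_p j).
    by rewrite lexx ltW.
  exists M; split=> [x|i]; first exact: (ub_bound U).
  have [q [q2 sb]] := H i; exists q => [x|x]; last exact: (sb_d1 (sb x)).
  have [_ + _] := sb_bound (sb x) 0.
  by rewrite /line scale0r addr0.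
(* [M0] bounds [f], hence the lower bound of [u]. The factor 2 comes from [wc_plus] and [wc_minus]:
   Taylor's formula across the whole step gives [C * (2 * eps)^2], and [half_diff] takes half of
   it. *)
exists (expR (- M0)), (2 * C); split; [exact: expR_gt0|exact: mulr_ge0|move=> eps e0].
have CC : C <= 2 * C by lra.
have taylor x i (a t : R) : `|line u x i (a + t) - line u x i a - t * line (p i) x i a|
    <= C * t ^+ 2.
  have [_ /(_ i)[q hq Dq]] := hC i.
  by apply: (@taylor_order2 _ _ (line (p i) x i) (line q x i)) => z; [exact: derive_u|exact: hq].
split.
- by move=> x; rewrite /u ler_expR; have := hM0 x; rewrite ler_norml => /andP[].
- by move=> j x; have [hj _] := hC j; exact: le_trans CC.
- move=> i x; apply: (@half_diff_le _ (p i)) => // y.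
  by have [hj _] := hC i; exact: le_trans CC.
- move=> i j x; have [_ /(_ i)[q hq Dq]] := hC j.
  by apply: (@half_diff_le _ q) => // y; exact: le_trans CC.
- move=> i x; have := taylor x i eps (- 2 * eps).
  rewrite (_ : eps + - 2 * eps = - eps); last by ring.
  rewrite /line scaleNr /half_diff.
  move: (u _) (u _) (p i _) => a b c; rewrite !ler_norml => /andP[h1 h2].
  apply/andP; split; lra.
- move=> i x; have := taylor x i (- eps) (2 * eps).
  rewrite (_ : - eps + 2 * eps = eps); last by ring.
  rewrite /line scaleNr /half_diff.
  move: (u _) (u _) (p i _) => a b c; rewrite !ler_norml => /andP[h1 h2].
  apply/andP; split; lra.
Qed.

Lemma log_walk_le : exists2 K, 0 <= K & forall m eps, (0 < m)%N -> 0 <= eps <= 1 ->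
  eps ^+ 2 * m%:R = 1 ->
  ln (1 + walk eps (sweep m n) exp_excess 0) <=
    walk eps (sweep m n) bell_excess 0 + K * eps.
Proof.
have [c [C [c0 C0 wc]]] := walk_class_exp.
have [K K0 hK] := @bell_walk R n _ _ c0 C0.
exists (n%:R * K) => [|m eps m0 e01 em]; first exact: mulr_ge0.
have /andP[e0 _] := e01.
have cnt j : 0 + eps ^+ 2 * (count_mem j (sweep m n : seq 'I_n))%:R = 1.
  by rewrite count_sweep em add0r.
have cnt1 j : 0 + eps ^+ 2 * (count_mem j (sweep m n : seq 'I_n))%:R <= 1.
  by rewrite cnt.
have H := hK eps (sweep m n) u p (fun=> 0) 0 e01 (wc _ e0) (fun=> lexx _) cnt1.
move: H; rewrite size_sweep.
rewrite big1 => [|j _]; last by rewrite mul0r.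
have -> : (n * m)%:R * (K * eps ^+ 3) = n%:R * K * eps.
  rewrite natrM (_ : _ * _ = n%:R * K * eps * (eps ^+ 2 * m%:R)); last by ring.
  by rewrite em mulr1.
have -> : walk eps (sweep m n) u 0 = 1 + walk eps (sweep m n) exp_excess 0.
  rewrite addrC -walkD_cst; congr walk; apply/funext => x.
  by rewrite /u /exp_excess subrK.
have -> : (fun y => bell (u y)
      (\sum_j (0 + eps ^+ 2 * (count_mem j (sweep m n : seq 'I_n))%:R) * p j y ^+ 2)) =
    (fun y => bell_excess y + psi 0).
  apply/funext => y; rewrite /bell /u expRK.
  under eq_bigr do rewrite cnt mul1r /p exprMn.
  rewrite -mulr_sumr mulrAC mulfV ?expf_neq0 ?gt_eqF ?expR_gt0// mul1r.
  by rewrite /bell_excess /sq_grad addrA subrK.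
(* With all clocks at 0 the left side carries [psi 0], which cancels the one split off from the
   final value. *)
by rewrite walkD_cst /bell mul0r addrAC lerD2r.
Qed.

End exponential.

(** * From the walk to expectations *)

Section expectations.
Context {R : realType} {n : nat} {d : measure_display} {T : measurableType d}.
Variables (P : probability T R) (X : T -> 'rV[R]_n).
Hypothesis hX : std_gaussian_vector P X.

Lemma integrable_bump (phi : 'rV[R]_n -> R) : bump phi ->
  P.-integrable [set: T] (EFin \o (fun w => phi (X w))).
Proof.
move=> B; apply: (integrable_roundable hX) => theta t0.
have [M _ hM] := bump_bounded B.
have [k hk] := unif_bump_rounding (bump_unif_bump B hM) t0.
by exists k => x; apply: hk; exact: rounded_partly.
Qed.

Lemma expectation_Rintegral (Y : T -> R) : P.-integrable [set: T] (EFin \o Y) ->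
  ('E_P[Y] = (\int[P]_w Y w)%:E)%E.
Proof. by move=> iY; rewrite unlock /Rintegral fineK// integrable_fin_num. Qed.

Lemma integrable_addC (Y : T -> R) (a : R) : P.-integrable [set: T] (EFin \o Y) ->
  P.-integrable [set: T] (EFin \o (fun w => Y w + a)).
Proof.
move=> iY; have ia : P.-integrable [set: T] (EFin \o cst a).
  exact: finite_measure_integrable_cst.
by have := integrableD measurableT iY ia; under eq_fun do rewrite -EFinD.
Qed.

Lemma RintegralD_cst (Y : T -> R) (a : R) : P.-integrable [set: T] (EFin \o Y) ->
  \int[P]_w (Y w + a) = \int[P]_w Y w + a.
Proof.
move=> iY; rewrite RintegralD//; last exact: finite_measure_integrable_cst.
by rewrite Rintegral_cst1.
Qed.

Lemma integrable_mulC (Y : T -> R) (a : R) : P.-integrable [set: T] (EFin \o Y) ->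
  P.-integrable [set: T] (EFin \o (fun w => a * Y w)).
Proof.
by move=> iY; have := integrableZl measurableT a iY; under eq_fun do rewrite -EFinM.
Qed.

Lemma expR_le_1D2 (x : R) : 0 <= x <= 1 / 2 -> expR x <= 1 + 2 * x.
Proof.
move=> /andP[x0 x2]; have := expR_ge1Dx (- x); rewrite expRN => h.
have e0 : 0 < expR x by exact: expR_gt0.
have : (1 - x) * expR x <= 1 by rewrite -ler_pdivlMr// div1r.
nra.
Qed.

Variable f : 'rV[R]_n -> R.
Hypotheses (hf : smooth f) (hc : compactly_supported f).

(** The logarithm is removed before the limit: the error of the central limit theorem for
    [exp_excess] stays additive outside the exponential, and the possibility [1 + Wa <= 0], where
    [ln] carries no information, is trivial. *)
Lemma exp_excess_le :
  1 + \int[P]_w exp_excess f (X w) <= expR (\int[P]_w bell_excess f (X w)).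
Proof.
set Ea := Rintegral _ _ _; set Eb := Rintegral _ _ _.
have step theta : 0 < theta -> 1 + Ea <= expR (Eb + 2 * theta) + theta.
  move=> t0; have [K K0 hK] := log_walk_le hf hc.
  have [r1 r10 h1] := bump2_clt hX (bump2_exp_excess hf hc) t0.
  have [r2 r20 h2] := bump2_clt hX (bump2_bell_excess hf hc) t0.
  have K1 : 0 < K + 1 by rewrite ltr_wpDl.
  have [|m [eps [m0 /andP[e0 er] em]]] := @small_steps R
    (Num.min (Num.min r1 r2) (Num.min 1 (theta / (K + 1)))).
    by rewrite !lt_min r10 r20 ltr01 divr_gt0.
  move: er; rewrite !le_min => /andP[/andP[er1 er2] /andP[er3 er4]].
  have {}h1 := h1 m eps m0; rewrite e0 er1 in h1; have {}h1 := h1 isT em.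
  have {}h2 := h2 m eps m0; rewrite e0 er2 in h2; have {}h2 := h2 isT em.
  have {}hK := hK m eps m0; rewrite e0 er3 in hK; have {}hK := hK isT em.
  have Ke : K * eps <= theta.
    move: er4; rewrite ler_pdivlMr// => er4; apply: le_trans er4.
    by rewrite mulrC ler_wpM2l// lerDl.
  move: h1 h2 hK; rewrite -/Ea -/Eb.
  set Wa := walk _ _ _ _; set Wb := walk _ _ _ _ => h1 h2 hK.
  have W : 1 + Wa <= expR (Eb + 2 * theta).
    have [W0|W0] := lerP (1 + Wa) 0; first exact: le_trans (expR_ge0 _).
    rewrite -[1 + Wa]lnK ?posrE// ler_expR; apply: (le_trans hK).
    by move: h2; rewrite ler_norml => /andP[h2 _]; lra.
  by move: h1; rewrite ler_norml => /andP[_ h1]; lra.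
apply/ler_addgt0Pr => e e0; pose E := expR Eb.
have E0 : 0 < E by exact: expR_gt0.
(* The bound [1 / 4] allows [expR (2 * theta) <= 1 + 4 * theta]; the other term then makes the total
   excess [(4 * E + 1) * theta] at most [e]. *)
pose theta := Num.min (1 / 4) (e / (4 * E + 1)).
have t0 : 0 < theta by rewrite lt_min !divr_gt0// ltr_wpDl// mulr_ge0// ltW.
apply: (le_trans (step _ t0)); rewrite expRD -/E.
have t4 : theta <= 1 / 4 by rewrite ge_min lexx.
have te : theta * (4 * E + 1) <= e.
  by rewrite -ler_pdivlMr ?ge_min ?lexx ?orbT// ltr_wpDl// mulr_ge0// ltW.
have := @expR_le_1D2 (2 * theta); rewrite (_ : 0 <= _ <= _); last by apply/andP; split; lra.
move=> /(_ isT) H; have := ler_wpM2l (ltW E0) H; lra.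
Qed.

End expectations.

Lemma sq_enorm {R : realType} {n : nat} (x : 'rV[R]_n) :
  enorm x ^+ 2 = \sum_i x ord0 i ^+ 2.
Proof. by rewrite sqr_sqrtr// sumr_ge0// => i _; exact: sqr_ge0. Qed.

Lemma sq_gradE {R : realType} {n : nat} (f : 'rV[R]_n -> R) x :
  sq_grad f x = enorm (grad f x) ^+ 2.
Proof. by rewrite sq_enorm; apply: eq_bigr => i _; rewrite mxE. Qed.

Theorem theorem1p1 (R : realType) (n : nat) (hn : (1 <= n)%N)
    (d : measure_display) (T : measurableType d) (P : probability T R)
    (X : T -> 'rV[R]_n) (hX : std_gaussian_vector P X)
    (f : 'rV[R]_n -> R) (hf : smooth f) (hc : compactly_supported f) :
  (lne 'E_P[fun w => (expR (f (X w) - fine 'E_P[fun w' => f (X w')]))%R]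
   <= 10%:E * 'E_P[fun w => (expR (2^-1 * enorm (grad f (X w)) ^+ 2)
                             * (1 + enorm (grad f (X w)))^-1)%R])%E.
Proof.
have bf : bump f := smooth_bump_partials [::] hf hc.
have iE := integrable_bump hX bf.
have ia := integrable_bump hX (proj1 (bump2_exp_excess hf hc)).
have ib := integrable_bump hX (proj1 (bump2_bell_excess hf hc)).
pose H (t : R) := expR (2^-1 * t) * (1 + Num.sqrt t)^-1.
have cH : continuous H.
  move=> t; apply: cvgM.
    apply: (cvg_comp (fun t => 2^-1 * t) expR); last exact: continuous_expR.
    by apply: cvgM; [exact: cvg_cst|exact: cvg_id].
  apply: cvgV; first by rewrite gt_eqF// ltr_pwDl// sqrtr_ge0.
  by apply: (@cvgD _ R^o); [exact: cvg_cst|exact: sqrt_continuous].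
(* As a function of the squared gradient the right-hand integrand is continuous, but it equals [H 0]
   off the support of the gradient; integrability is obtained for the difference first. *)
have bG : bump (fun x => H (sq_grad f x) - H 0).
  apply: (@bump_comp _ _ (fun t => H t - H 0)); last exact: (proj1 (bump2_sq_grad hf hc)).
    by move=> x; apply: (@cvgB _ R^o); [exact: cH|exact: cvg_cst].
  by rewrite subrr.
have iG : P.-integrable [set: T] (EFin \o (fun w => H (sq_grad f (X w)))).
  have := integrable_addC (H 0) (integrable_bump hX bG).
  by under eq_fun do rewrite subrK.
have GE w : expR (2^-1 * enorm (grad f (X w)) ^+ 2) * (1 + enorm (grad f (X w)))^-1 =
    H (sq_grad f (X w)).
  by rewrite /H sq_gradE sqrtr_sqr ger0_norm ?sqrtr_ge0.
rewrite (_ : (fun w => expR (2^-1 * _) * _) = (fun w => H (sq_grad f (X w)))); last first.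
  by apply/funext.
rewrite (expectation_Rintegral iE) /=.
set c := \int[P]_w f (X w).
rewrite (_ : (fun w => expR _) = (fun w => expR (- c) * (exp_excess f (X w) + 1))); last first.
  by apply/funext => w; rewrite /exp_excess subrK expRD mulrC.
have ia1 := integrable_addC 1 ia.
rewrite (expectation_Rintegral (integrable_mulC (expR (- c)) ia1)).
rewrite (expectation_Rintegral iG) RintegralZl// RintegralD_cst//.
have Ea0 : 0 <= \int[P]_w exp_excess f (X w) + 1.
  rewrite -RintegralD_cst//; apply: Rintegral_ge0 => w _.
  by rewrite /exp_excess subrK expR_ge0.
have LE := exp_excess_le hX hf hc.
set Eb := \int[P]_w bell_excess f (X w) in LE.
apply: (@le_trans _ _ (Eb - c)%:E).
  have -> : (Eb - c)%:E = lne (expR (Eb - c))%:E by rewrite lne_EFin ?expR_gt0// expRK.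
  rewrite lee_lne ?in_itv/= ?leey ?andbT ?lee_fin ?expR_ge0//.
    by rewrite [Eb - c]addrC expRD ler_wpM2l ?expR_ge0// addrC.
  by rewrite mulr_ge0 ?expR_ge0.
rewrite -EFinM lee_fin -RintegralB// -RintegralZl//.
apply: le_Rintegral => //.
- have := integrableB measurableT ib iE.
  by under eq_fun do rewrite -EFinB.
- exact: integrable_mulC.
(* The difference [bell_excess f - f] is [psi (|grad f|^2) - psi 0]; dropping [psi 0 > 0] leaves
   [psi_ub]. *)
move=> w _; rewrite /bell_excess addrAC subrr add0r sq_gradE.
have := psi_ub (sqrtr_ge0 _ : 0 <= enorm (grad f (X w))); rewrite GE sq_gradE.
by have := @psi_gt0 R 0; lra.
Qed.
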